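(* Let $\Lambda\subset\mathbb{R}$ be a discrete set. There exists a function $\varphi\in L^1(\mathbb{R})$ such that the linear span of the translates $\varphi(t-\lambda)$, $\lambda\in\Lambda$, is dense in $L^1(\mathbb{R})$ if and only if $R(\Lambda)=+\infty$.
   Context: For $\Lambda\subset\mathbb{R}$, let $\mathcal{E}(\Lambda)$ denote the linear span of the exponentials $e^{i\lambda\zeta}$, $\lambda\in\Lambda$. The spectral (completeness) radius is $R(\Lambda)=\sup\{\rho>0:\ \mathcal{E}(\Lambda)\text{ is complete (dense) in } C[-\rho,\rho]\}$, with $R(\Lambda)=0$ if $\mathcal{E}(\Lambda)$ is complete in $C[-\rho,\rho]$ for no $\rho>0$. Here $C[-\rho,\rho]$ is the space of continuous functions on $[-\rho,\rho]$ with the sup-norm. *)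

(* Defs.v *)
From HB Require Import structures.
From mathcomp Require Import all_boot all_order all_algebra.
From mathcomp Require Import all_classical all_reals all_analysis.
From mathcomp Require Import complex.
Set Implicit Arguments. Unset Strict Implicit. Unset Printing Implicit Defensive.
Import Order.TTheory GRing.Theory Num.Theory.
Import numFieldNormedType.Exports.
Local Open Scope classical_set_scope.
Local Open Scope ring_scope.

Section Defs.
Variable R : realType.

Definition cabs (z : R[i]) : R := Normc.normc z.

Definition expi (t : R) : R[i] := Complex (cos t) (sin t).

(* Lambda is discrete: no finite accumulation point, i.e. every bounded
   interval contains only finitely many points of Lambda. *)
Definition discrete_set (L : set R) : Prop :=
  forall a b : R, finite_set (L `&` `[a, b]).

Definition exp_poly (s : seq (R[i] * R)) (x : R) : R[i] :=
  \sum_(p <- s) p.1 * expi (p.2 * x).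

Definition exp_complete (L : set R) (rho : R) : Prop :=
  forall f : R -> R[i],
    {within `[- rho, rho], continuous (fun x => complex.Re (f x))} ->
    {within `[- rho, rho], continuous (fun x => complex.Im (f x))} ->
    forall eps : R, 0 < eps ->
      exists s : seq (R[i] * R),
        (forall p, p \in s -> L p.2) /\
        (forall x, x \in `[- rho, rho] -> cabs (f x - exp_poly s x) < eps).

(* spectral (completeness) radius R(Lambda) in \bar R;
   the extra element 0 implements the convention R(Lambda) = 0 when the set is empty. *)
Definition spectral_radius (L : set R) : \bar R :=
  ereal_sup ([set 0%E] `|` [set (rho%:E)%E | rho in [set rho : R | 0 < rho /\ exp_complete L rho]]).

Definition L1 (f : R -> R[i]) : Prop :=
  (@lebesgue_measure R).-integrable setT (fun x => (complex.Re (f x))%:E) /\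
  (@lebesgue_measure R).-integrable setT (fun x => (complex.Im (f x))%:E).

Definition L1dist (f g : R -> R[i]) : \bar R :=
  (\int[@lebesgue_measure R]_x (cabs (f x - g x))%:E)%E.

Definition transl_comb (phi : R -> R[i]) (s : seq (R[i] * R)) (t : R) : R[i] :=
  \sum_(p <- s) p.1 * phi (t - p.2).

Definition translates_dense (L : set R) (phi : R -> R[i]) : Prop :=
  forall g : R -> R[i], L1 g ->
    forall eps : R, 0 < eps ->
      exists s : seq (R[i] * R),
        (forall p, p \in s -> L p.2) /\ (L1dist g (transl_comb phi s) < eps%:E)%E.

End Defs.

(* Main.v *)
Require Import Defs.
From HB Require Import structures.
From mathcomp Require Import all_boot all_order all_algebra.
From mathcomp Require Import all_classical all_reals all_analysis.
From mathcomp Require Import complex.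
From mathcomp Require Import measurable_realfun.
From mathcomp Require Import ring lra.
Import Order.TTheory GRing.Theory Num.Theory.
Import numFieldNormedType.Exports.
Local Open Scope classical_set_scope.
Local Open Scope ring_scope.

Set Implicit Arguments.
Unset Strict Implicit.
Unset Printing Implicit Defensive.

(* (=>) Let F g (x) be the integral of g(t) e^(ixt). If the translates of phi are
   dense then F phi has no zero, because F of a combination of translates is an
   exponential polynomial times F phi. Given f continuous on [[- rho, rho]],
   approximate f * F phi uniformly there by some F g with g in L^1, and g in L^1
   by a combination of translates of phi; dividing by F phi approximates f by
   the corresponding exponential polynomial.

   (<=) Choose phi as the inverse Fourier transform of W = sum_n eps_n B_n, where
   the B_n >= 0 are compactly supported C^2 bumps covering the line.
   Completeness in C[-rho, rho] for all rho improves to completeness in the C^2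
   norm, by convolving with a tent function, and two integrations by parts turn
   C^2 closeness on a compact set into closeness in the weighted norm
   sup (1 + t^2)|g(t)|, hence in L^1. A target whose transform Psi is C^2 and
   supported where a partial sum W' of W is positive has transform W' (Psi / W').
   Approximating Psi / W' by exponentials e^(i lambda x) thus approximates the
   target by translates of the inverse transform of W', and the next eps_n are
   taken so small that they do not spoil the approximations chosen so far.
   Countably many targets suffice: the functions b(t) cos(qt) and b(t) sin(qt),
   with q rational and b the transform of a narrow bump. They span L^1 because a
   continuous compactly supported function divided by b is approximated on a long
   interval by a trigonometric polynomial with rational frequencies which is
   bounded on the whole line. *)

(** The obstacle in (<=) is that [W] must be positive on the whole line, while completeness gives
    information on compact intervals only. An approximation can therefore take account of a partial
    sum only, and the later coefficients must be small against it; but it depends itself on the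
    coefficients chosen before. The circle is broken by selecting in advance an approximation for
    every target and every finite list of positive coefficients that is long enough for it; [eps n]
    is then a function of its predecessors. Each target is treated at all late stages [n] with an
    error of order [2^-n], so every tolerance is reached. Errors are compared with
    [wt t = 1 / (1 + t ^ 2)]: it is integrable, two integrations by parts produce it, and a
    translation by [a] costs at most the factor [2 (1 + a ^ 2)], so a fixed combination of
    translates acts as a bounded operator. That side of the proof is real: [W] is even, and the
    symbols of the targets have an even real and an odd imaginary part, so real coefficients
    suffice. *)

(** * Weierstrass approximation *)

(* The mean of [F] under the binomial distribution of parameters [n] and [x],
   i.e. Bernstein's operator. *)
Fixpoint bern (R : realType) (n : nat) (F : nat -> R) (x : R) : R :=
  if n is m.+1 then x * bern m (fun k => F k.+1) x + (1 - x) * bern m F x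
  else F 0%N.

Section Bernstein.
Variable R : realType.
Implicit Types (F G : nat -> R) (x : R).

Lemma bern_cst n (c x : R) : bern n (fun=> c) x = c.
Proof. by elim: n => //= n ->; ring. Qed.

Lemma bernD n F G x :
  bern n (fun k => F k + G k) x = bern n F x + bern n G x.
Proof. by elim: n F G => //= n IH F G; rewrite !IH; ring. Qed.

Lemma bernZ n (c : R) F x : bern n (fun k => c * F k) x = c * bern n F x.
Proof. by elim: n F => //= n IH F; rewrite !IH; ring. Qed.

Lemma bern_le n F G x : 0 <= x <= 1 -> (forall k, (k <= n)%N -> F k <= G k) ->
  bern n F x <= bern n G x.
Proof.
move=> /andP[x0 x1]; elim: n F G => [|n IH] F G FG /=; first exact: FG.
by apply: lerD; apply: ler_wpM2l => //; rewrite ?subr_ge0//; apply: IH => k kn;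
  apply: FG => //; exact: leqW.
Qed.

(** Variance plus squared bias of the binomial law. The centre [a] is arbitrary because the
    induction step moves it by one. *)
Lemma bern_sqr n (a x : R) :
  bern n (fun k => (k%:R - a) ^+ 2) x = n%:R * x * (1 - x) + (n%:R * x - a) ^+ 2.
Proof.
elim: n a => [|n IH] a /=; first by ring.
have -> : (fun k : nat => (k.+1%:R - a) ^+ 2) = (fun k => (k%:R - (a - 1)) ^+ 2 : R).
  by apply/funext => k; rewrite -natr1; ring.
by rewrite !IH -natr1; ring.
Qed.

Lemma bern_ge n F (m x : R) : 0 <= x <= 1 -> (forall k, (k <= n)%N -> m <= F k) ->
  m <= bern n F x.
Proof. by move=> x01 Fm; rewrite -[leLHS](bern_cst n m x); exact: bern_le. Qed.

Lemma bern_norm_le n F (M x : R) : 0 <= x <= 1 ->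
  (forall k, (k <= n)%N -> `|F k| <= M) -> `|bern n F x| <= M.
Proof.
move=> x01 FM; rewrite ler_norml bern_ge//=; last first.
  by move=> k /FM; rewrite ler_norml => /andP[].
rewrite -[leRHS](bern_cst n M x); apply: bern_le => // k /FM.
by rewrite ler_norml => /andP[].
Qed.

(** Compactness in its near-covering form. Only [x] is confined to the segment, so that points just
    beyond its ends can be compared too. *)
Lemma unif_continuous_segment (f : R -> R) (A d : R) : continuous f -> 0 < d ->
  exists2 eta : R, 0 < eta &
    forall x y, `|x| <= A -> `|x - y| < eta -> `|f x - f y| < d.
Proof.
move=> cf d0.
have := @segment_compact R (- A) A; move/compact_near_coveringP.
move=> /(_ _ (0 : R)^'+ (fun eta x => forall y, `|x - y| < eta -> `|f x - f y| < d)).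
case.
  move=> x _; have d20 : 0 < d / 2 by rewrite divr_gt0.
  have /cvgrPdist_lt/(_ _ d20) := cf x.
  move/nbhs_ballP => [e /= e0 He].
  exists (ball x (e / 2), [set t | 0 < t < e / 2]) => /=.
    split; first by apply: nbhsx_ballx; rewrite divr_gt0.
    near=> t; apply/andP; split; near: t; first exact: nbhs_right_gt.
    by apply: nbhs_right_lt; rewrite divr_gt0.
  move=> [x' t] /= [xx' /andP[t0 te]] y x'y.
  have h1 := He x'.
  have h2 := He y.
  move: xx'; rewrite /ball/= => xx'.
  have {}h1 : `|f x - f x'| < d / 2 by apply: h1; rewrite /ball/=; apply: lt_trans xx' _; lra.
  have {}h2 : `|f x - f y| < d / 2.
    apply: h2; rewrite /ball/=.
    rewrite (_ : x - y = (x - x') + (x' - y)); last by ring.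
    by apply: le_lt_trans (ler_normD _ _) _; lra.
  rewrite (_ : f x' - f y = - (f x - f x') + (f x - f y)); last by ring.
  by apply: le_lt_trans (ler_normD _ _) _; rewrite normrN; lra.
move=> e /= e0 He; exists (e / 2); first by rewrite divr_gt0.
move=> x y xA; apply: (He (e / 2)) => //=.
- by rewrite sub0r normrN ger0_norm; lra.
- by rewrite divr_gt0.
- by rewrite in_itv/= -ler_norml.
Unshelve. all: by end_near. Qed.

Lemma bern_cvg (f : R -> R) (d K : R) : continuous f -> 0 < d ->
  (forall x, `|f x| <= K) ->
  exists n : nat, forall x, 0 <= x <= 1 ->
    `|bern n (fun k => f (k%:R / n%:R)) x - f x| <= d.
Proof.
move=> cf d0 fK.
have d20 : 0 < d / 2 by rewrite divr_gt0.
have [e e0 He] := unif_continuous_segment 1 cf d20.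
have K0 : 0 <= K by apply: le_trans (fK 0).
(* This size makes the mean of the quadratic part of [D] below, [2 K x (1 - x) / (e ^+ 2 n)], at
   most [d / 2]. *)
pose n := (Num.truncn (4 * K / (e ^+ 2 * d))).+1.
have nbig : 4 * K / (e ^+ 2 * d) < n%:R by exact: truncnS_gt.
have n0 : (0 : R) < n%:R by rewrite ltr0n.
exists n => x x01.
have e2 : 0 < e ^+ 2 by rewrite exprn_gt0.
rewrite -[X in _ - X](bern_cst n (f x) x).
rewrite -[X in _ - X]mul1r -mulNr -bernZ -bernD.
(* Chebyshev's argument: for [k / n] within [e] of [x] the term [d / 2] dominates the oscillation of
   [f], and elsewhere the quadratic term is at least [2 K]. *)
pose D k : R := d / 2 + 2 * K / e ^+ 2 / n%:R ^+ 2 * (k%:R - n%:R * x) ^+ 2.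
have Dbd : forall k, (k <= n)%N -> `|f (k%:R / n%:R) + (-1) * f x| <= D k.
  move=> k _; rewrite mulN1r.
  have [xk|xk] := ltP (`|x - k%:R / n%:R|) e.
    rewrite distrC; apply: (le_trans (ltW (He x _ _ xk))).
      by rewrite ger0_norm; case/andP: x01.
    rewrite lerDl mulr_ge0 ?sqr_ge0// divr_ge0 ?sqr_ge0// divr_ge0 ?sqr_ge0//.
    by rewrite mulr_ge0.
  have h : `|f (k%:R / n%:R) - f x| <= 2 * K.
    by apply: le_trans (ler_normB _ _) _; have := fK x; have := fK (k%:R / n%:R); lra.
  apply: (le_trans h); rewrite /D -lerBlDl.
  have -> : 2 * K / e ^+ 2 / n%:R ^+ 2 * (k%:R - n%:R * x) ^+ 2 =
            2 * K * ((x - k%:R / n%:R) ^+ 2 / e ^+ 2).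
    by field; rewrite ?gt_eqF//.
  have : 1 <= (x - k%:R / n%:R) ^+ 2 / e ^+ 2.
    rewrite ler_pdivlMr// mul1r -[leRHS]ger0_norm ?sqr_ge0// normrX.
    by rewrite lerXn2r// ?nnegrE ?normr_ge0// ltW.
  move: ((x - k%:R / n%:R) ^+ 2 / e ^+ 2) => y y1.
  have : 2 * K * 1 <= 2 * K * y by rewrite ler_wpM2l// mulr_ge0.
  by lra.
have main : bern n D x <= d.
  rewrite (bernD n (fun=> d / 2)
    (fun k => 2 * K / e ^+ 2 / n%:R ^+ 2 * (k%:R - n%:R * x) ^+ 2)) bern_cst.
  rewrite (bernZ n _ (fun k => (k%:R - n%:R * x) ^+ 2)) bern_sqr.
  rewrite subrr expr0n /= addr0.
  suff : 2 * K / e ^+ 2 / n%:R ^+ 2 * (n%:R * x * (1 - x)) <= d / 2 by lra.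
  have -> : 2 * K / e ^+ 2 / n%:R ^+ 2 * (n%:R * x * (1 - x)) =
     2 * K / e ^+ 2 / n%:R * (x * (1 - x)) by field; rewrite ?gt_eqF.
  have xx : x * (1 - x) <= 1 by nra.
  have : 2 * K / e ^+ 2 / n%:R * (x * (1 - x)) <= 2 * K / e ^+ 2 / n%:R * 1.
    by rewrite ler_wpM2l// !divr_ge0 ?mulr_ge0// ltW.
  move/le_trans; apply; rewrite mulr1 ler_pdivrMr//.
  move: nbig; rewrite ltr_pdivrMr ?mulr_gt0// => nbig.
  rewrite ler_pdivrMr//; nra.
rewrite ler_norml; apply/andP; split.
  rewrite lerNl; set F := (fun k => _).
  rewrite -[leLHS]mulN1r -bernZ; apply: le_trans main; apply: bern_le => // k kn.
  by rewrite mulN1r lerNl; have := Dbd k kn; rewrite ler_norml => /andP[].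
by apply: le_trans main; apply: bern_le => // k /Dbd; rewrite ler_norml => /andP[].
Qed.

End Bernstein.

(** * Exponential and trigonometric polynomials *)

Section ExpPoly.
Variable R : realType.
Implicit Types (s : seq (R[i] * R)) (x t : R).

Lemma complex_eq (z w : R[i]) : complex.Re z = complex.Re w ->
  complex.Im z = complex.Im w -> z = w.
Proof. by case: z w => [a b] [c d] /= -> ->. Qed.

Lemma ReD (z w : R[i]) : complex.Re (z + w) = complex.Re z + complex.Re w.
Proof. by case: z w => [? ?] []. Qed.

Lemma ImD (z w : R[i]) : complex.Im (z + w) = complex.Im z + complex.Im w.
Proof. by case: z w => [? ?] []. Qed.

Lemma ReN (z : R[i]) : complex.Re (- z) = - complex.Re z.
Proof. by case: z. Qed.

Lemma ImN (z : R[i]) : complex.Im (- z) = - complex.Im z.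
Proof. by case: z. Qed.

Lemma ReM (z w : R[i]) : complex.Re (z * w) =
  complex.Re z * complex.Re w - complex.Im z * complex.Im w.
Proof. by case: z w => [? ?] []. Qed.

Lemma ImM (z w : R[i]) : complex.Im (z * w) =
  complex.Re z * complex.Im w + complex.Im z * complex.Re w.
Proof. by case: z w => [? ?] []. Qed.

Lemma Re_sum (I : Type) (r : seq I) (F : I -> R[i]) :
  complex.Re (\sum_(i <- r) F i) = \sum_(i <- r) complex.Re (F i).
Proof. by elim/big_rec2: _ => // i y z _ <-; rewrite ReD. Qed.

Lemma Im_sum (I : Type) (r : seq I) (F : I -> R[i]) :
  complex.Im (\sum_(i <- r) F i) = \sum_(i <- r) complex.Im (F i).
Proof. by elim/big_rec2: _ => // i y z _ <-; rewrite ImD. Qed.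

Lemma cabs_ge0 (z : R[i]) : 0 <= cabs z.
Proof. by case: z => a b; rewrite /cabs /= sqrtr_ge0. Qed.

Lemma cabs_Re (z : R[i]) : `|complex.Re z| <= cabs z.
Proof.
case: z => a b; rewrite /cabs /= -sqrtr_sqr ler_sqrt ?lerDl ?sqr_ge0//.
by rewrite addr_ge0// sqr_ge0.
Qed.

Lemma cabs_Im (z : R[i]) : `|complex.Im z| <= cabs z.
Proof.
case: z => a b; rewrite /cabs /= -sqrtr_sqr ler_sqrt ?lerDr ?sqr_ge0//.
by rewrite addr_ge0// sqr_ge0.
Qed.

Lemma cabs_le (z : R[i]) : cabs z <= `|complex.Re z| + `|complex.Im z|.
Proof.
case: z => a b; rewrite /cabs /=.
rewrite -[leRHS]ger0_norm ?addr_ge0// -sqrtr_sqr ler_sqrt ?sqr_ge0//.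
rewrite sqrrD !real_normK ?num_real// -addrA [_ *+ 2 + _]addrC addrA lerDl.
by rewrite mulrn_wge0// mulr_ge0.
Qed.

Lemma cabsD (z w : R[i]) : cabs (z + w) <= cabs z + cabs w.
Proof. exact: le_normcD. Qed.

Lemma cabsM (z w : R[i]) : cabs (z * w) = cabs z * cabs w.
Proof. exact: Normc.normcM. Qed.

Lemma cabs_eq0 (z : R[i]) : cabs z = 0 -> z = 0.
Proof. exact: Normc.eq0_normc. Qed.

Lemma expiD x t : expi (x + t) = expi x * expi t.
Proof.
by apply: complex_eq; rewrite ?ReM ?ImM /= ?cosD ?sinD; ring.
Qed.

Lemma expi0 : expi (0 : R) = 1.
Proof. by rewrite /expi cos0 sin0. Qed.

Lemma exp_poly_nil x : exp_poly [::] x = 0 :> R[i].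
Proof. by rewrite /exp_poly big_nil. Qed.

Lemma exp_poly_cons p s x : exp_poly (p :: s) x = p.1 * expi (p.2 * x) + exp_poly s x.
Proof. by rewrite /exp_poly big_cons. Qed.

Lemma exp_poly_cat s1 s2 x : exp_poly (s1 ++ s2) x = exp_poly s1 x + exp_poly s2 x.
Proof. by rewrite /exp_poly big_cat. Qed.

Lemma Re_exp_poly s x : complex.Re (exp_poly s x) =
  \sum_(p <- s) (complex.Re p.1 * cos (p.2 * x) - complex.Im p.1 * sin (p.2 * x)).
Proof. by rewrite Re_sum; apply: eq_bigr => p _; rewrite ReM. Qed.

Lemma Im_exp_poly s x : complex.Im (exp_poly s x) =
  \sum_(p <- s) (complex.Re p.1 * sin (p.2 * x) + complex.Im p.1 * cos (p.2 * x)).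
Proof. by rewrite Im_sum; apply: eq_bigr => p _; rewrite ImM. Qed.

Definition trig_poly (D : set R) (h : R -> R) : Prop := exists s : seq (R[i] * R),
  (forall p, p \in s -> D p.2) /\ (forall x, exp_poly s x = Complex (h x) 0).

Section closure.
Variable D : set R.
Hypotheses (D0 : D 0) (DD : forall a b, D a -> D b -> D (a + b)).

Lemma trig_poly_cst (c : R) : trig_poly D (fun=> c).
Proof.
exists [:: (Complex c 0, 0)]; split => [p|x].
  by rewrite inE => /eqP ->.
rewrite exp_poly_cons exp_poly_nil /= mul0r expi0 addr0 mulr1.
by [].
Qed.

Lemma trig_polyD f g : trig_poly D f -> trig_poly D g ->
  trig_poly D (fun x => f x + g x).
Proof.
move=> [s [sD sf]] [s' [sD' sg]]; exists (s ++ s'); split => [p|x].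
  by rewrite mem_cat => /orP[/sD|/sD'].
by rewrite exp_poly_cat sf sg; apply: complex_eq; rewrite ?ReD ?ImD/= ?addr0.
Qed.

Lemma trig_polyM f g : trig_poly D f -> trig_poly D g ->
  trig_poly D (fun x => f x * g x).
Proof.
move=> [s [sD sf]] [s' [sD' sg]].
exists [seq (p.1 * q.1, p.2 + q.2) | p <- s, q <- s']; split => [p|x].
  by move=> /allpairsP[[a b] /= [/sD ? /sD' ? ->]]; exact: DD.
have -> : Complex (f x * g x) 0 = Complex (f x) 0 * Complex (g x) 0.
  by apply: complex_eq; rewrite ?ReM ?ImM/=; ring.
rewrite -sf -sg /exp_poly big_allpairs_dep/= mulr_suml; apply: eq_bigr => p _.
rewrite mulr_sumr; apply: eq_bigr => q _ /=.
by rewrite mulrDl expiD; ring.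
Qed.

Lemma trig_poly_sin (w : R) : D w -> D (- w) -> trig_poly D (fun x => sin (w * x)).
Proof.
move=> Dw DNw.
exists [:: (Complex 0 (- 2^-1), w); (Complex 0 (2^-1), - w)]; split => [p|x].
  by rewrite !inE => /orP[] /eqP ->.
rewrite !exp_poly_cons exp_poly_nil addr0 /= mulNr.
by apply: complex_eq; rewrite ?ReD ?ImD ?ReM ?ImM/= ?sinN ?cosN; field.
Qed.

Lemma trig_poly_bern n (F : nat -> R) g : trig_poly D g ->
  trig_poly D (fun x => bern n F (g x)).
Proof.
move=> Dg; elim: n F => [|n IH] F /=; first exact: trig_poly_cst.
apply: trig_polyD; apply: trig_polyM => //.
apply: trig_polyD; first exact: trig_poly_cst.
under eq_fun do rewrite -mulN1r.
by apply: trig_polyM => //; exact: trig_poly_cst.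
Qed.

End closure.

(* The approximation is only local but the bound on [Q] is global. [Q] is a
   Bernstein polynomial in [(1 + sin (x / M)) / 2]. *)
Lemma trig_poly_approx (f : R -> R) (L d K : R) : continuous f -> 0 < d ->
  (forall x, `|f x| <= K) ->
  exists Q : R -> R, [/\ trig_poly [set ratr q | q in [set: rat]] Q,
    (forall x, `|x| <= L -> `|f x - Q x| <= d) & (forall x, `|Q x| <= K)].
Proof.
move=> cf d0 fK.
(* An integer, so that the frequency [1 / M] is rational; larger than [L], so that
   [|x / M| <= 1 < pi / 2] where the sine has to be inverted. *)
pose M : nat := (Num.truncn L).+1.
have LM : L < M%:R by exact: truncnS_gt.
have M0 : (0 : R) < M%:R by rewrite ltr0n.
pose s0 : R := sin 1.
have s01 : s0 < 1.
  rewrite lt_neqAle sin_le1 andbT; apply/eqP => s1.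
  have := @cos1_gt0 R; have := cos2Dsin2 (1 : R); rewrite -/s0 s1 expr1n.
  by nra.
have pi1 := @pihalf_ge1 R.
have pi1' : 1 < pi / 2 :> R.
  rewrite lt_neqAle pi1 andbT; apply/eqP => h.
  by have := @cos1_gt0 R; rewrite h cos_pihalf ltxx.
have s0_gt0 : 0 < s0 by rewrite /s0 sin_gt0_pihalf// ltr01.
(* Keeps the argument of [asin] inside the open interval where it is continuous, and changes nothing
   at [sin (x / M)] for [|x| <= L]. *)
pose clip (y : R) := Num.max (- s0) (Num.min y s0).
have clip_in y : - s0 <= clip y <= s0.
  by rewrite /clip le_max ge_max lexx/= ge_min lexx orbT andbT; lra.
have ccl : continuous clip.
  move=> y; apply: (@continuous_max _ _ (cst (- s0)) (fun z : R => Num.min z s0)).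
    exact: cst_continuous.
  by apply: (@continuous_min _ _ idfun (cst s0)) => //; exact: cst_continuous.
pose g y := f (M%:R * asin (clip (2 * y - 1))).
have cg : continuous g.
  move=> y; apply: continuous_comp; last exact: cf.
  apply: cvgM; first exact: cvg_cst.
  apply: continuous_comp; last first.
    apply: continuous_asin; have := clip_in (2 * y - 1); lra.
  apply: continuous_comp; last exact: ccl.
  by apply: cvgB; [apply: cvgM; [exact: cvg_cst|exact: cvg_id]|exact: cvg_cst].
have gK y : `|g y| <= K by exact: fK.
have [n Hn] := bern_cvg cg d0 gK.
pose u x : R := 2^-1 + 2^-1 * sin (M%:R^-1 * x).
have u01 x : 0 <= u x <= 1.
  by have := sin_le1 (M%:R^-1 * x); have := sin_geN1 (M%:R^-1 * x); rewrite /u; lra.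
exists (fun x => bern n (fun k => g (k%:R / n%:R)) (u x)); split.
- have D0 : [set (ratr q : R) | q in [set: rat]] 0 by exists 0 => //; rewrite rmorph0.
  have DD (a b : R) : [set (ratr q : R) | q in [set: rat]] a ->
    [set (ratr q : R) | q in [set: rat]] b -> [set (ratr q : R) | q in [set: rat]] (a + b).
    by move=> [q _ <-] [r _ <-]; exists (q + r) => //; rewrite rmorphD.
  apply: trig_poly_bern => //; apply: trig_polyD; first exact: trig_poly_cst.
  apply: trig_polyM => //; first exact: trig_poly_cst.
  apply: trig_poly_sin.
  + by exists (M%:R^-1) => //; rewrite fmorphV/= ratr_nat.
  + by exists (- M%:R^-1) => //; rewrite rmorphN fmorphV/= ratr_nat.
- move=> x xL; rewrite distrC; have := Hn _ (u01 x).
  suff -> : g (u x) = f x by [].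
  rewrite /g; congr f.
  have -> : 2 * u x - 1 = sin (M%:R^-1 * x) by rewrite /u; field.
  have xM : -1 <= M%:R^-1 * x <= 1.
    rewrite -ler_norml normrM ger0_norm ?invr_ge0// mulrC ler_pdivrMr// mul1r.
    by rewrite (le_trans xL)// ltW.
  have : - s0 <= sin (M%:R^-1 * x) <= s0.
    rewrite /s0 -sinN !leNgt; case/andP : xM => h1 h2.
    by apply/andP; split; rewrite ltr_sin ?in_itv/= -?leNgt//; lra.
  rewrite /clip => /andP[h1 h2].
  rewrite min_l// max_r// sinK; last by rewrite in_itv/=; lra.
  by field; rewrite gt_eqF.
- by move=> x; apply: bern_norm_le => //; exact: u01.
Qed.

End ExpPoly.

(** * C^2 functions and smoothing *)

Section Calculus.
Variable R : realType.
Implicit Types (f g H : R -> R) (x y h : R).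

Lemma derD f g x a b : is_derive x 1 f a -> is_derive x 1 g b ->
  is_derive x 1 (fun y => f y + g y) (a + b).
Proof. by move=> fa gb; exact: is_deriveD. Qed.

Lemma derB f g x a b : is_derive x 1 f a -> is_derive x 1 g b ->
  is_derive x 1 (fun y => f y - g y) (a - b).
Proof. by move=> fa gb; exact: is_deriveB. Qed.

Lemma derM f g x a b : is_derive x 1 f a -> is_derive x 1 g b ->
  is_derive x 1 (fun y => f y * g y) (a * g x + f x * b).
Proof.
move=> fa gb; apply: (is_derive_eq (is_deriveM fa gb)).
by rewrite addrC; congr (_ + _); rewrite mulrC.
Qed.

Lemma der_cst (c x : R) : is_derive x 1 (fun=> c) 0.
Proof. exact: is_derive_cst. Qed.

Lemma derZ f (c x a : R) : is_derive x 1 f a -> is_derive x 1 (fun y => c * f y) (c * a).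
Proof.
move=> fa; apply: (is_derive_eq (derM (der_cst c x) fa)); ring.
Qed.

Lemma der_comp f g x a b : is_derive x 1 g b -> is_derive (g x) 1 f a ->
  is_derive x 1 (fun y => f (g y)) (a * b).
Proof. by move=> gb fa; apply: (is_derive_eq (is_derive1_comp _ _)). Qed.

Lemma derV f x a : f x != 0 -> is_derive x 1 f a ->
  is_derive x 1 (fun y => (f y)^-1) (- a / f x ^+ 2).
Proof.
move=> fx0 fa; apply: (is_derive_eq (is_deriveV fx0 fa)).
by rewrite /GRing.scale/= mulNr mulNr mulrC.
Qed.

Lemma der_continuous f x a : is_derive x 1 f a -> {for x, continuous f}.
Proof.
by move=> [df _]; apply: differentiable_continuous; exact/derivable1_diffP.
Qed.

Lemma der_affine (c d x : R) : is_derive x 1 (fun y => c * y + d) c.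
Proof.
apply: (is_derive_eq (derD (derZ c (is_derive_id x 1)) (der_cst d x))).
by rewrite mulr1 addr0.
Qed.

Lemma der_cosa (c d x : R) :
  is_derive x 1 (fun y => cos (c * y + d)) (- (c * sin (c * x + d))).
Proof.
apply: (is_derive_eq (der_comp (der_affine c d x) (is_derive_cos _))); ring.
Qed.

Lemma der_sina (c d x : R) :
  is_derive x 1 (fun y => sin (c * y + d)) (c * cos (c * x + d)).
Proof.
apply: (is_derive_eq (der_comp (der_affine c d x) (is_derive_sin _))); ring.
Qed.

(** The derivatives are arguments, so that bounds on them can be stated for explicit formulas;
    [smooth2] hides them where their existence is enough. *)
Record C2 (f f1 f2 : R -> R) : Prop := {
  C2_d1 : forall x, is_derive x 1 f (f1 x) ;
  C2_d2 : forall x, is_derive x 1 f1 (f2 x) ;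
  C2_c : continuous f2 }.

Lemma C2_cont f f1 f2 : C2 f f1 f2 -> continuous f.
Proof. by case=> d _ _ x; exact: der_continuous (d x). Qed.

Lemma C2_cont1 f f1 f2 : C2 f f1 f2 -> continuous f1.
Proof. by case=> _ d _ x; exact: der_continuous (d x). Qed.

Definition smooth2 f := exists f1 f2, C2 f f1 f2.

Lemma smooth2_cst (c : R) : smooth2 (fun=> c).
Proof.
exists (fun=> 0), (fun=> 0); split => [x|x|]; try exact: der_cst.
exact: cst_continuous.
Qed.

Lemma smooth2_affine (c d : R) : smooth2 (fun x => c * x + d).
Proof.
exists (fun=> c), (fun=> 0); split => [x|x|]; [exact: der_affine|exact: der_cst|].
exact: cst_continuous.
Qed.

Lemma smooth2_cosa (c d : R) : smooth2 (fun x => cos (c * x + d)).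
Proof.
exists (fun x => - c * sin (c * x + d)), (fun x => - c ^+ 2 * cos (c * x + d)).
split => [x|x|x].
- by apply: (is_derive_eq (der_cosa c d x)); ring.
- by apply: (is_derive_eq (derZ (- c) (der_sina c d x))); ring.
- exact: der_continuous (derZ _ (der_cosa c d x)).
Qed.

Lemma C2D f f1 f2 g g1 g2 : C2 f f1 f2 -> C2 g g1 g2 ->
  C2 (fun x => f x + g x) (fun x => f1 x + g1 x) (fun x => f2 x + g2 x).
Proof.
move=> [df df1 cf] [dg dg1 cg]; split => [x|x|x]; try exact: derD.
by apply: cvgD; [exact: cf|exact: cg].
Qed.

Lemma C2B f f1 f2 g g1 g2 : C2 f f1 f2 -> C2 g g1 g2 ->
  C2 (fun x => f x - g x) (fun x => f1 x - g1 x) (fun x => f2 x - g2 x).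
Proof.
move=> [df df1 cf] [dg dg1 cg]; split => [x|x|x]; try exact: derB.
by apply: cvgB; [exact: cf|exact: cg].
Qed.

Lemma C2M f f1 f2 g g1 g2 : C2 f f1 f2 -> C2 g g1 g2 ->
  C2 (fun x => f x * g x) (fun x => f1 x * g x + f x * g1 x)
     (fun x => f2 x * g x + 2 * (f1 x * g1 x) + f x * g2 x).
Proof.
move=> Cf Cg; have cf := C2_cont Cf; have cf1 := C2_cont1 Cf.
have cg := C2_cont Cg; have cg1 := C2_cont1 Cg.
case: Cf Cg => [df df1 cf2] [dg dg1 cg2]; split => [x|x|x].
- exact: derM.
- by apply: (is_derive_eq (derD (derM (df1 x) (dg x)) (derM (df x) (dg1 x)))); ring.
- apply: cvgD; [apply: cvgD|]; last by apply: cvgM; [exact: cf|exact: cg2].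
    by apply: cvgM; [exact: cf2|exact: cg].
  apply: cvgM; first exact: cvg_cst.
  by apply: cvgM; [exact: cf1|exact: cg1].
Qed.

Lemma smooth2D f g : smooth2 f -> smooth2 g -> smooth2 (fun x => f x + g x).
Proof. by move=> [f1 [f2 Cf]] [g1 [g2 Cg]]; exact: ex_intro _ _ (ex_intro _ _ (C2D Cf Cg)). Qed.

Lemma smooth2B f g : smooth2 f -> smooth2 g -> smooth2 (fun x => f x - g x).
Proof. by move=> [f1 [f2 Cf]] [g1 [g2 Cg]]; exact: ex_intro _ _ (ex_intro _ _ (C2B Cf Cg)). Qed.

Lemma smooth2M f g : smooth2 f -> smooth2 g -> smooth2 (fun x => f x * g x).
Proof. by move=> [f1 [f2 Cf]] [g1 [g2 Cg]]; exact: ex_intro _ _ (ex_intro _ _ (C2M Cf Cg)). Qed.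

Lemma smooth2_continuous f : smooth2 f -> continuous f.
Proof. by move=> [f1 [f2 /C2_cont]]. Qed.

Lemma smooth2V f : (forall x, f x != 0) -> smooth2 f -> smooth2 (fun x => (f x)^-1).
Proof.
move=> f0 [f1 [f2 Cf]]; have cf := C2_cont Cf; have cf1 := C2_cont1 Cf.
case: Cf => df df1 cf2.
have dV x := derV (f0 x) (df x).
have dV2 x := derM (dV x) (dV x).
exists (fun x => - 1 * (f1 x * ((f x)^-1 * (f x)^-1))).
exists (fun x => - 1 * (f2 x * ((f x)^-1 * (f x)^-1) +
  f1 x * (- f1 x / f x ^+ 2 * (f x)^-1 + (f x)^-1 * (- f1 x / f x ^+ 2)))).
have cV x : (f y)^-1 @[y --> x] --> (f x)^-1 by apply: cvgV => //; exact: cf.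
split => [x|x|x].
- apply: (is_derive_eq (dV x)); field; exact: f0.
- exact: (derZ (- 1) (derM (df1 x) (dV2 x))).
- apply: cvgM; first exact: cvg_cst.
  have c1 : - f1 y / f y ^+ 2 @[y --> x] --> - f1 x / f x ^+ 2.
    under eq_fun do rewrite -exprVn expr2.
    rewrite -exprVn expr2; apply: cvgM; last by apply: cvgM; exact: cV.
    by apply: cvgN; exact: cf1.
  apply: cvgD; apply: cvgM; [exact: cf2|by apply: cvgM; exact: cV|exact: cf1|].
  by apply: cvgD; apply: cvgM; first [exact: cV|exact: c1].
Qed.

(** The cube is the lowest integer power of the positive part that is C^2. All bumps are obtained by
    composing it with polynomials. *)
Definition pos3 (y : R) : R := Num.max y 0 ^+ 3.

Lemma cont_pos : continuous (fun y : R => Num.max y 0).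
Proof.
move=> y; apply: (@continuous_max _ _ idfun (cst 0)); last exact: cst_continuous.
exact: cvg_id.
Qed.

Lemma der_pow n x : is_derive x 1 (fun y : R => y ^+ n.+1) (n.+1%:R * x ^+ n).
Proof.
elim: n => [|n IH].
  by under eq_fun do rewrite expr1; rewrite expr0 mulr1; exact: is_derive_id.
under eq_fun do rewrite exprS.
apply: (is_derive_eq (derM (is_derive_id x 1) IH)).
by rewrite -[in RHS]natr1 exprS; ring.
Qed.

Lemma der_posX n x : is_derive x 1 (fun y : R => Num.max y 0 ^+ n.+2)
  (n.+2%:R * Num.max x 0 ^+ n.+1).
Proof.
have [x0|x0|x0] := ltgtP x 0.
- rewrite expr0n/= mulr0.
  apply: (near_eq_is_derive _ (der_cst 0 x)).
  by near=> z; rewrite max_r ?expr0n//= ltW//; near: z; exact: lt_nbhsl.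
- apply: (near_eq_is_derive _ (der_pow n.+1 x)).
  by near=> z; rewrite max_l// ltW//; near: z; exact: lt_nbhsr.
- rewrite x0 expr0n/= mulr0.
  (* At the corner the difference quotient is itself [Num.max h 0 ^+ n.+1], which tends to 0. *)
  have cv : (fun h => h^-1 *: (((fun y : R => Num.max y 0 ^+ n.+2) \o shift (0 : R)) (h *: (1 : R)) -
       (fun y : R => Num.max y 0 ^+ n.+2) 0)) @ 0^' --> (0 : R).
    rewrite (_ : (fun h => _) = (fun h : R => Num.max h 0 ^+ n.+1)); last first.
      apply/funext => h /=; rewrite /GRing.scale/= mulr1 addr0 maxxx expr0n/= subr0.
      have [h0|h0] := ltP 0 h; last by rewrite !expr0n/= mulr0.
      by rewrite [in LHS]exprS mulKf// gt_eqF.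
    rewrite [X in _ --> X](_ : 0 = Num.max (0 : R) 0 ^+ n.+1); last first.
      by rewrite maxxx expr0n.
    apply: (@cvg_within_filter _ _ _ (nbhs (0 : R)) _ _ _).
    apply: (@continuous_comp _ _ _ (fun y : R => Num.max y 0) (fun y => y ^+ n.+1)).
      exact: cont_pos.
    exact: exprn_continuous.
  apply: DeriveDef; first by apply/cvg_ex; exists 0.
  by apply/cvg_lim.
Unshelve. all: by end_near. Qed.

Lemma C2_pos3 : C2 pos3 (fun y => 3 * Num.max y 0 ^+ 2) (fun y => 6 * Num.max y 0).
Proof.
split => [x|x|x].
- exact: (@der_posX 1).
- apply: (is_derive_eq (derZ 3 (@der_posX 0 x))); rewrite expr1; ring.
- by apply: cvgM; [exact: cvg_cst|exact: cont_pos].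
Qed.

Lemma pos3_ge0 y : 0 <= pos3 y.
Proof. by rewrite exprn_ge0// le_max lexx orbT. Qed.

Lemma pos3_eq0 y : y <= 0 -> pos3 y = 0.
Proof. by move=> y0; rewrite /pos3 max_r// expr0n. Qed.

Lemma pos3_gt0 y : 0 < y -> 0 < pos3 y.
Proof. by move=> y0; rewrite /pos3 exprn_gt0// lt_max y0. Qed.

Lemma smooth2_pos3 f : smooth2 f -> smooth2 (fun x => pos3 (f x)).
Proof.
move=> [f1 [f2 Cf]]; have cf := C2_cont Cf; have cf1 := C2_cont1 Cf.
case: Cf => df df1 cf2; have [dp dp1 cp2] := C2_pos3.
have cp1 := C2_cont1 C2_pos3.
exists (fun x => 3 * Num.max (f x) 0 ^+ 2 * f1 x).
exists (fun x => 6 * Num.max (f x) 0 * f1 x * f1 x + 3 * Num.max (f x) 0 ^+ 2 * f2 x).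
split => [x|x|x].
- exact: (der_comp (df x) (dp _)).
- exact: (derM (der_comp (df x) (dp1 _)) (df1 x)).
- apply: cvgD; (apply: cvgM; [|exact: cf1 || exact: cf2]).
    apply: cvgM; last exact: cf1.
    exact: (continuous_comp (cf x) (cp2 _)).
  exact: (continuous_comp (cf x) (cp1 _)).
Qed.

Lemma mean_value f f1 (a b : R) : (forall x, is_derive x 1 f (f1 x)) -> a < b ->
  exists2 c, a < c < b & f b - f a = f1 c * (b - a).
Proof.
move=> df ab; have [|c] := MVT ab (fun x _ => df x).
  by apply: continuous_subspaceT => x; exact: der_continuous (df x).
by rewrite in_itv/= => cab ->; exists c.
Qed.

(** Two mean value theorems, the first for the increment [H (y + h) - H y] between [x - h] and
    [x]. *)
Lemma second_difference H H1 H2 x h : C2 H H1 H2 -> 0 < h ->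
  exists2 c, `|c - x| < h & H (x + h) - 2 * H x + H (x - h) = h ^+ 2 * H2 c.
Proof.
move=> [d1 d2 _] h0.
have dsh (F F1 : R -> R) : (forall x, is_derive x 1 F (F1 x)) ->
    forall y, is_derive y 1 (fun y => F (y + h) - F y) (F1 (y + h) - F1 y).
  move=> dF y; apply: derB => //.
  have := der_comp (der_affine 1 h y) (dF _).
  by under eq_fun do rewrite mul1r; rewrite mul1r mulr1.
have [|c /andP[c1 c2]] := mean_value (dsh _ _ d1) (_ : x - h < x).
  by rewrite ltrBlDr ltrDl.
rewrite subrK => e1.
have [|d /andP[dd1 dd2] e2] := mean_value d2 (_ : c < c + h); first by rewrite ltrDl.
exists d; first by rewrite ltr_norml; apply/andP; split; lra.
have -> : H (x + h) - 2 * H x + H (x - h) = H (x + h) - H x - (H x - H (x - h)) by ring.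
by rewrite e1 e2; ring.
Qed.

End Calculus.

(** * Exponential sums and the tent average *)

Section TrigSums.
Variable R : realType.
Implicit Types (s : seq (R * R)) (x h th : R).

(* [th = 0] gives sums of cosines and [th = - (pi / 2)] sums of sines: the real
   and imaginary parts of an exponential polynomial with real coefficients. *)
Definition cos_sum th s x := \sum_(p <- s) p.1 * cos (p.2 * x + th).
Definition cos_sum1 th s x := \sum_(p <- s) - (p.1 * p.2 * sin (p.2 * x + th)).
Definition cos_sum2 th s x := \sum_(p <- s) - (p.1 * p.2 ^+ 2 * cos (p.2 * x + th)).

Lemma C2_sum (I : Type) (r : seq I) (F F1 F2 : I -> R -> R) :
  (forall i, C2 (F i) (F1 i) (F2 i)) ->
  C2 (fun x => \sum_(i <- r) F i x) (fun x => \sum_(i <- r) F1 i x)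
     (fun x => \sum_(i <- r) F2 i x).
Proof.
move=> CF; elim: r => [|i r IH].
  under eq_fun do rewrite big_nil.
  under [X in C2 _ X _]eq_fun do rewrite big_nil.
  under [X in C2 _ _ X]eq_fun do rewrite big_nil.
  by split => [x|x|]; try exact: der_cst; exact: cst_continuous.
under eq_fun do rewrite big_cons.
under [X in C2 _ X _]eq_fun do rewrite big_cons.
under [X in C2 _ _ X]eq_fun do rewrite big_cons.
exact: C2D.
Qed.

Lemma C2_cos_sum th s : C2 (cos_sum th s) (cos_sum1 th s) (cos_sum2 th s).
Proof.
apply: C2_sum => p; split => [x|x|x].
- by apply: (is_derive_eq (derZ p.1 (der_cosa p.2 th x))); ring.
- under eq_fun do rewrite -mulNr.
  by apply: (is_derive_eq (derZ _ (der_sina p.2 th x))); ring.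
- under eq_fun do rewrite -mulNr.
  exact: der_continuous (derZ _ (der_cosa p.2 th x)).
Qed.

(* The Fourier multiplier of the convolution with the tent function supported
   on [[- h, h]]. *)
Definition tent_mult h (lam : R) : R :=
  if lam == 0 then 1 else (2 - 2 * cos (lam * h)) / (lam * h) ^+ 2.

Definition tent_smooth h s : seq (R * R) :=
  [seq (p.1 * tent_mult h p.2, p.2) | p <- s].

Definition cos_primitive2 th (lam x : R) : R :=
  if lam == 0 then cos th * x ^+ 2 / 2 else - cos (lam * x + th) / lam ^+ 2.

Lemma C2_cos_primitive2 th lam : exists p1 : R -> R,
  C2 (cos_primitive2 th lam) p1 (fun x => cos (lam * x + th)).
Proof.
rewrite /cos_primitive2; have [->|lam0] := eqVneq lam 0.
  exists (fun x => cos th * x); split => [x|x|x].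
  - under eq_fun do rewrite -mulrA [_ / 2]mulrC mulrA.
    by apply: (is_derive_eq (derZ _ (der_pow 1 x))); rewrite expr1; field.
  - by apply: (is_derive_eq (derZ _ (is_derive_id x 1))); rewrite mul0r add0r mulr1.
  - exact: der_continuous (der_cosa 0 th x).
exists (fun x => lam^-1 * sin (lam * x + th)); split => [x|x|x].
- under eq_fun do rewrite mulNr mulrC -mulNr.
  by apply: (is_derive_eq (derZ _ (der_cosa lam th x))); field.
- by apply: (is_derive_eq (derZ _ (der_sina lam th x))); field.
- exact: der_continuous (der_cosa lam th x).
Qed.

Lemma cos_addsub (a b : R) : cos (a + b) + cos (a - b) = 2 * (cos a * cos b).
Proof. by rewrite cosD cosB; ring. Qed.

(** The tent average is the second difference, divided by [h ^+ 2], of a second primitive; by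
    [second_difference] it is then a value of the original sum. No convolution integral has to be
    written. *)
Lemma tent_smooth_mean th s x h : 0 < h ->
  exists2 c, `|c - x| < h & cos_sum th (tent_smooth h s) x = cos_sum th s c.
Proof.
move=> h0; pose P p := fun y => p.1 * cos_primitive2 th p.2 y : R.
pose P1 p := fun y => p.1 * projT1 (cid (C2_cos_primitive2 th p.2)) y : R.
have CP : C2 (fun y => \sum_(p <- s) P p y) (fun y => \sum_(p <- s) P1 p y) (cos_sum th s).
  apply: C2_sum => p; rewrite /P /P1; case: cid => /= p1 [d1 d2 c].
  split => [y|y|y]; [exact: derZ|exact: derZ|].
  by apply: cvgM; [exact: cvg_cst|exact: c].
have [c cx e] := second_difference x CP h0; exists c => //.
apply: (mulfI (_ : h ^+ 2 != 0)); first by rewrite sqrf_eq0 gt_eqF.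
rewrite -e /cos_sum /tent_smooth big_map !mulr_sumr -sumrB -big_split/=.
apply: eq_bigr => p _; rewrite /P /cos_primitive2 /tent_mult.
have [->|l0] := eqVneq p.2 0; first by rewrite mul0r add0r; field.
have -> : p.2 * (x + h) + th = (p.2 * x + th) + p.2 * h by ring.
have -> : p.2 * (x - h) + th = (p.2 * x + th) - p.2 * h by ring.
have := cos_addsub (p.2 * x + th) (p.2 * h).
move/(canRL (addrK _)) => ->.
by field; rewrite ?l0 ?(gt_eqF h0).
Qed.

(** The second derivative of the tent consists of three point masses. Hence uniform closeness of the
    original sum controls the second derivative of the smoothed one, at the price of a division by
    [h ^+ 2]. *)
Lemma cos_sum2_tent th s x h : 0 < h -> h ^+ 2 * cos_sum2 th (tent_smooth h s) x =
  cos_sum th s (x + h) - 2 * cos_sum th s x + cos_sum th s (x - h).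
Proof.
move=> h0; rewrite /cos_sum2 /cos_sum /tent_smooth big_map !mulr_sumr -sumrB.
rewrite -big_split/=; apply: eq_bigr => p _; rewrite /tent_mult.
have -> : p.2 * (x + h) + th = (p.2 * x + th) + p.2 * h by ring.
have -> : p.2 * (x - h) + th = (p.2 * x + th) - p.2 * h by ring.
have := cos_addsub (p.2 * x + th) (p.2 * h).
move/(canRL (addrK _)) => ->.
have [->|l0] := eqVneq p.2 0; first by rewrite !mul0r cos0; ring.
by field; rewrite ?l0 ?(gt_eqF h0).
Qed.

(** A Landau inequality: the slope of [e] over [[x, x + 1]] is at most [2 * d], and [e1 x] differs
    from it by at most [d]. *)
Lemma derivative_interpolation (e e1 e2 : R -> R) x (d : R) : C2 e e1 e2 ->
  (forall y, x <= y <= x + 1 -> `|e y| <= d /\ `|e2 y| <= d) -> `|e1 x| <= 3 * d.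
Proof.
move=> [d1 d2 _] ed; have x1 : x < x + 1 by rewrite ltrDl.
have [c /andP[c1 c2]] := mean_value d1 x1.
have -> : x + 1 - x = 1 by ring.
rewrite mulr1 => ec; have [b /andP[b1 b2] eb] := mean_value d2 c1.
have [hx _] : `|e x| <= d /\ `|e2 x| <= d by apply: ed; lra.
have [hx1 _] : `|e (x + 1)| <= d /\ `|e2 (x + 1)| <= d by apply: ed; lra.
have [_ hb] : `|e b| <= d /\ `|e2 b| <= d by apply: ed; lra.
have -> : e1 x = e (x + 1) - e x - e2 b * (c - x) by lra.
apply: (le_trans (ler_normB _ _)).
have : `|e2 b * (c - x)| <= d.
  rewrite normrM (ger0_norm (_ : 0 <= c - x)); last by lra.
  have := normr_ge0 (e2 b); nra.
have := ler_normB (e (x + 1)) (e x); lra.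
Qed.

(** The width [h] is fixed first, by the moduli of continuity of [f] and [f2]; the tolerance [d0]
    then pays for the division by [h ^+ 2]. All small [h] are allowed, so that two functions can
    share one. The margin 2 is one unit for [derivative_interpolation] and one for [h < 1]. *)
Lemma tent_smooth_close (f f1 f2 : R -> R) (rho d : R) : C2 f f1 f2 -> 0 < d ->
  exists2 h0 : R, 0 < h0 & forall h, 0 < h < h0 ->
  exists2 d0 : R, 0 < d0 & forall th s,
    (forall x, `|x| <= rho + 2 -> `|cos_sum th s x - f x| <= d0) ->
    forall x, `|x| <= rho ->
      [/\ `|cos_sum th (tent_smooth h s) x - f x| <= d,
          `|cos_sum1 th (tent_smooth h s) x - f1 x| <= d &
          `|cos_sum2 th (tent_smooth h s) x - f2 x| <= d].
Proof.
move=> Cf d0; have cf := C2_cont Cf; have cf2 := C2_c Cf.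
have d60 : 0 < d / 6 by rewrite divr_gt0.
have [ha ha0 Ha] := unif_continuous_segment (rho + 1) cf d60.
have [hb hb0 Hb] := unif_continuous_segment (rho + 1) cf2 d60.
exists (Num.min 1 (Num.min ha hb)); first by rewrite !lt_min ltr01 ha0.
move=> h; rewrite !lt_min => /andP[h0 /and3P[h1 hha hhb]].
have hh0 : 0 < h ^+ 2 by rewrite exprn_gt0.
(* The weights 1, 2, 1 of a second difference turn an error [d * h ^+ 2 / 24] into
   [d * h ^+ 2 / 6]. *)
exists (Num.min (d / 6) (d * h ^+ 2 / 24)).
  by rewrite lt_min d60 divr_gt0// mulr_gt0.
move=> th s Hs.
have {}Hs y : `|y| <= rho + 2 ->
    `|cos_sum th s y - f y| <= d / 6 /\ `|cos_sum th s y - f y| <= d * h ^+ 2 / 24.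
  by move=> /Hs; rewrite le_min => /andP[].
have near x y a : `|y| <= a -> `|x - y| <= h -> `|x| <= a + h.
  move=> ya xy; rewrite (_ : x = y + (x - y)); last by ring.
  by apply: (le_trans (ler_normD _ _)); lra.
have CS := C2_cos_sum th (tent_smooth h s).
have CE := C2B CS Cf.
have close y : `|y| <= rho + 1 ->
    `|cos_sum th (tent_smooth h s) y - f y| <= d / 3 /\
    `|cos_sum2 th (tent_smooth h s) y - f2 y| <= d / 3.
  move=> yr; split.
    have [c cy ->] := tent_smooth_mean th s y h0.
    have [|h1' _] := Hs c; first by have := near _ _ _ yr (ltW cy); lra.
    have := Ha y c yr; rewrite distrC => /(_ (lt_trans cy hha)) h2.
    have -> : cos_sum th s c - f y = (cos_sum th s c - f c) - (f y - f c) by ring.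
    by apply: (le_trans (ler_normB _ _)); lra.
  have [c cy e] := second_difference y Cf h0.
  have := Hb y c yr; rewrite distrC => /(_ (lt_trans cy hhb)) h2.
  have e2 := cos_sum2_tent th s y h0.
  have [|_ b1] := Hs (y + h).
    by have := near (y + h) _ _ yr; rewrite addrAC subrr add0r gtr0_norm// => /(_ (lexx _)); lra.
  have [|_ b2] := Hs y; first by lra.
  have [|_ b3] := Hs (y - h).
    by have := near (y - h) _ _ yr; rewrite addrAC subrr add0r normrN gtr0_norm// => /(_ (lexx _)); lra.
  have -> : cos_sum2 th (tent_smooth h s) y - f2 y =
    (cos_sum2 th (tent_smooth h s) y - f2 c) - (f2 y - f2 c) by ring.
  apply: (le_trans (ler_normB _ _)).
  suff : `|cos_sum2 th (tent_smooth h s) y - f2 c| <= d / 6 by lra.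
  rewrite -(ler_pM2l hh0) -{1}(gtr0_norm hh0) -normrM mulrBr e2 -e.
  move: b1 b2 b3; rewrite !ler_norml => /andP[? ?] /andP[? ?] /andP[? ?].
  by apply/andP; split; lra.
move=> x xr; have xr1 : `|x| <= rho + 1 by lra.
have [e0 e2] := close x xr1; split; [by lra| |by lra].
have h3 : d = 3 * (d / 3) by field.
rewrite h3; apply: (derivative_interpolation CE) => y /andP[y1 y2]; apply: close.
have -> : y = x + (y - x) by ring.
by apply: (le_trans (ler_normD _ _)); rewrite (ger0_norm (_ : 0 <= y - x)); lra.
Qed.

(* For such a pair, replacing the coefficients by their real parts amounts to
   averaging the error at [x] with its conjugate at [- x]. *)
Lemma exp_complete_cos_sum (L : set R) (rho d : R) (f g : R -> R) :
  exp_complete L rho -> continuous f -> continuous g ->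
  (forall x, f (- x) = f x) -> (forall x, g (- x) = - g x) -> 0 < d ->
  exists s, (forall p, p \in s -> L p.2) /\
    forall x, `|x| <= rho ->
      `|cos_sum 0 s x - f x| <= d /\ `|cos_sum (- (pi / 2)) s x - g x| <= d.
Proof.
move=> HL cf cg fe go d0.
have [||s [sL Hs]] := HL (fun x => Complex (f x) (g x)) _ _ d d0.
- exact: continuous_subspaceT.
- exact: continuous_subspaceT.
exists [seq (complex.Re p.1, p.2) | p <- s]; split => [p /mapP[q /sL ? ->]//|x xr].
pose A := \sum_(p <- s) complex.Re p.1 * cos (p.2 * x).
pose B := \sum_(p <- s) complex.Im p.1 * sin (p.2 * x).
pose A' := \sum_(p <- s) complex.Re p.1 * sin (p.2 * x).
pose B' := \sum_(p <- s) complex.Im p.1 * cos (p.2 * x).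
have -> : cos_sum 0 [seq (complex.Re p.1, p.2) | p <- s] x = A.
  by rewrite /cos_sum big_map; apply: eq_bigr => p _; rewrite addr0.
have -> : cos_sum (- (pi / 2)) [seq (complex.Re p.1, p.2) | p <- s] x = A'.
  by rewrite /cos_sum big_map; apply: eq_bigr => p _; rewrite cosBpihalf.
have R1 : complex.Re (exp_poly s x) = A - B by rewrite Re_exp_poly sumrB.
have R2 : complex.Re (exp_poly s (- x)) = A + B.
  rewrite Re_exp_poly -big_split/=; apply: eq_bigr => p _.
  by rewrite mulrN cosN sinN mulrN opprK.
have I1 : complex.Im (exp_poly s x) = A' + B' by rewrite Im_exp_poly big_split.
have I2 : complex.Im (exp_poly s (- x)) = - A' + B'.
  rewrite Im_exp_poly -sumrN -big_split/=; apply: eq_bigr => p _.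
  by rewrite mulrN cosN sinN mulrN.
have xin : x \in `[- rho, rho] by rewrite in_itv/= -ler_norml.
have Nxin : - x \in `[- rho, rho] by rewrite in_itv/= -ler_norml normrN.
have h1 := Hs _ xin; have h2 := Hs _ Nxin.
have a1 := le_trans (cabs_Re _) (ltW h1); have a2 := le_trans (cabs_Re _) (ltW h2).
have b1 := le_trans (cabs_Im _) (ltW h1); have b2 := le_trans (cabs_Im _) (ltW h2).
move: a1 a2 b1 b2; rewrite !ReD !ImD !ReN !ImN R1 R2 I1 I2 /= fe go.
rewrite !ler_norml => /andP[? ?] /andP[? ?] /andP[? ?] /andP[? ?].
by split; apply/andP; split; lra.
Qed.

Lemma exp_complete_C2 (L : set R) (rho d : R) (f f1 f2 g g1 g2 : R -> R) :
  (forall r : R, exp_complete L r) -> C2 f f1 f2 -> C2 g g1 g2 ->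
  (forall x, f (- x) = f x) -> (forall x, g (- x) = - g x) -> 0 < d ->
  exists s, (forall p, p \in s -> L p.2) /\
    forall x, `|x| <= rho ->
      [/\ `|cos_sum 0 s x - f x| <= d, `|cos_sum1 0 s x - f1 x| <= d &
          `|cos_sum2 0 s x - f2 x| <= d] /\
      [/\ `|cos_sum (- (pi / 2)) s x - g x| <= d,
          `|cos_sum1 (- (pi / 2)) s x - g1 x| <= d &
          `|cos_sum2 (- (pi / 2)) s x - g2 x| <= d].
Proof.
move=> HL Cf Cg fe go d0.
have [hf hf0 Hf] := tent_smooth_close rho Cf d0.
have [hg hg0 Hg] := tent_smooth_close rho Cg d0.
(* The same smoothed coefficients must serve [f] and [g], hence one width strictly below both
   thresholds. *)
pose h := Num.min hf hg / 2.
have m0 : 0 < Num.min hf hg by rewrite lt_min hf0.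
have m1 : Num.min hf hg <= hf by rewrite ge_min lexx.
have m2 : Num.min hf hg <= hg by rewrite ge_min lexx orbT.
have [|df df0 {}Hf] := Hf h; first by rewrite /h; apply/andP; split; lra.
have [|dg dg0 {}Hg] := Hg h; first by rewrite /h; apply/andP; split; lra.
have dd : 0 < Num.min df dg by rewrite lt_min df0.
have [s [sL Hs]] :=
  exp_complete_cos_sum (HL (rho + 2)) (C2_cont Cf) (C2_cont Cg) fe go dd.
exists (tent_smooth h s); split => [p /mapP[q /sL ? ->]//|x xr].
split; [apply: Hf => // y yr|apply: Hg => // y yr]; have [] := Hs y yr;
  by rewrite !le_min => /andP[? ?] /andP[? ?].
Qed.

End TrigSums.

(** * Integrals over the line *)

Section RealIntegral.
Variable R : realType.
Notation mu := (@lebesgue_measure R).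
Implicit Types (f g G : R -> R) (x t a r : R).

Definition L1R f := mu.-integrable setT (EFin \o f).

Lemma L1R_measurable f : L1R f -> measurable_fun setT f.
Proof. by move=> /integrableP[/measurable_EFinP]. Qed.

Lemma L1RD f g : L1R f -> L1R g -> L1R (fun x => f x + g x).
Proof. by move=> hf hg; exact: (integrableD measurableT hf hg). Qed.

Lemma L1RZ c f : L1R f -> L1R (fun x => c * f x).
Proof. by move=> hf; exact: (integrableZl measurableT c hf). Qed.

Lemma L1RB f g : L1R f -> L1R g -> L1R (fun x => f x - g x).
Proof. by move=> hf hg; exact: (integrableB measurableT hf hg). Qed.

Lemma L1R0 : L1R (fun=> 0).
Proof. exact: integrable0. Qed.

Lemma le_L1R f g : measurable_fun setT f -> (forall x, `|f x| <= g x) -> L1R g -> L1R f.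
Proof.
move=> mf fg hg; apply: le_integrable hg => //; first exact/measurable_EFinP.
by move=> x _ /=; rewrite lee_fin (le_trans (fg x))// ler_norm.
Qed.

Lemma L1R_norm f : L1R f -> L1R (fun x => `|f x|).
Proof.
move=> hf; apply: (le_integrable measurableT _ _ hf) => //.
  by apply/measurable_EFinP; apply: measurableT_comp => //; exact: L1R_measurable.
by move=> x _ /=; rewrite normr_id.
Qed.

Lemma L1R_mulbd f g (K : R) : L1R f -> measurable_fun setT g ->
  (forall x, `|g x| <= K) -> L1R (fun x => f x * g x).
Proof.
move=> hf mg gK; apply: (@le_L1R _ (fun x => K * `|f x|)).
- by apply: measurable_funM => //; exact: L1R_measurable.
- by move=> x; rewrite normrM mulrC ler_wpM2r.
- exact: L1RZ (L1R_norm hf).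
Qed.

Lemma RintD f g : L1R f -> L1R g ->
  \int[mu]_x (f x + g x) = \int[mu]_x f x + \int[mu]_x g x.
Proof. by move=> hf hg; exact: RintegralD. Qed.

Lemma RintB f g : L1R f -> L1R g ->
  \int[mu]_x (f x - g x) = \int[mu]_x f x - \int[mu]_x g x.
Proof. by move=> hf hg; exact: RintegralB. Qed.

Lemma RintZ c f : L1R f -> \int[mu]_x (c * f x) = c * \int[mu]_x f x.
Proof. by move=> hf; exact: RintegralZl. Qed.

Lemma L1R_sum (I : Type) (s : seq I) (F : I -> R -> R) : (forall i, L1R (F i)) ->
  L1R (fun x => \sum_(i <- s) F i x).
Proof.
move=> hF; elim: s => [|i s IH].
  by under eq_fun do rewrite big_nil; exact: L1R0.
by under eq_fun do rewrite big_cons; exact: L1RD.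
Qed.

Lemma Rint0 : \int[mu]_x (0 : R) = 0.
Proof. by rewrite /Rintegral integral0. Qed.

Lemma Rint_sum (I : Type) (s : seq I) (F : I -> R -> R) : (forall i, L1R (F i)) ->
  \int[mu]_x (\sum_(i <- s) F i x) = \sum_(i <- s) \int[mu]_x F i x.
Proof.
move=> hF; elim: s => [|i s IH].
  by under eq_Rintegral do rewrite big_nil; rewrite big_nil Rint0.
under eq_Rintegral do rewrite big_cons.
by rewrite RintD// ?IH ?big_cons//; exact: L1R_sum.
Qed.

Lemma le_Rint f g : L1R f -> L1R g -> (forall x, f x <= g x) ->
  \int[mu]_x f x <= \int[mu]_x g x.
Proof. by move=> hf hg fg; apply: le_Rintegral. Qed.

Lemma norm_Rint f : L1R f -> `|\int[mu]_x f x| <= \int[mu]_x `|f x|.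
Proof. by move=> hf; exact: le_normr_Rintegral. Qed.

Lemma Rint_ge0 f : (forall x, 0 <= f x) -> 0 <= \int[mu]_x f x.
Proof. by move=> f0; exact: Rintegral_ge0. Qed.

Lemma integral_EFin f : L1R f -> (\int[mu]_x (f x)%:E)%E = (\int[mu]_x f x)%:E.
Proof. by move=> hf; rewrite fineK//; exact: integrable_fin_num. Qed.

Definition shift_by a : measurableTypeR R -> measurableTypeR R := fun x : R => x - a.

Lemma measurable_shift a : measurable_fun setT (shift_by a).
Proof.
by apply: continuous_measurable_fun => x; apply: cvgB; [exact: cvg_id|exact: cvg_cst].
Qed.

Lemma lebesgue_shift a (A : set R) : measurable A ->
  mu A = pushforward mu (shift_by a) A.
Proof.
move=> mA; apply: lebesgue_measure_unique => //=.
  exact: measurable_shift.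
move=> m X [[x y] _ <-] /=; rewrite /pushforward.
have -> : shift_by a @^-1` `]x, y] = `]x + a, y + a]%classic.
  by apply/seteqP; split => z /=; rewrite !in_itv/= ltrBrDr lerBlDr.
rewrite !lebesgue_measure_itv/= !lte_fin ltrD2r; case: ifP => // _.
by rewrite -!EFinD; congr EFin; ring.
Qed.

Lemma ge0_integral_shift a (f : R -> \bar R) : measurable_fun setT f ->
  (forall x, (0 <= f x)%E) -> (\int[mu]_x f (shift_by a x) = \int[mu]_x f x)%E.
Proof.
move=> mf f0.
transitivity (\int[pushforward mu (shift_by a)]_y f y)%E.
  by rewrite (ge0_integral_pushforward (measurable_shift a))// preimage_setT.
apply: eq_measure_integral => /=; first exact: measurable_shift.
by move=> ? A mA _; exact/esym/lebesgue_shift.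
Qed.

Lemma L1R_shift a f : L1R f -> L1R (fun x => f (x - a)).
Proof.
move=> hf; have mf := L1R_measurable hf.
apply/integrableP; split.
  by apply/measurable_EFinP; apply: (measurableT_comp mf); exact: measurable_shift.
rewrite (ge0_integral_shift a (f := fun x => `|(f x)%:E|%E))//.
  by case/integrableP : hf.
by apply: measurableT_comp => //; exact/measurable_EFinP.
Qed.

Lemma Rint_shift a f : L1R f -> \int[mu]_x f (shift_by a x) = \int[mu]_x f x.
Proof.
move=> hf; rewrite /Rintegral; congr fine.
have h2 : mu.-integrable (shift_by a @^-1` setT) ((EFin \o f) \o shift_by a).
  by rewrite preimage_setT; exact: L1R_shift.
have mf : measurable_fun setT (EFin \o f) by case/integrableP : hf.
transitivity (\int[pushforward mu (shift_by a)]_y (EFin \o f) y)%E.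
  by rewrite (integral_pushforward (measurable_shift a) mf h2)// preimage_setT.
apply: eq_measure_integral => /=; first exact: measurable_shift.
by move=> ? A mA _; exact/esym/lebesgue_shift.
Qed.

Definition supported r f := forall x, r < `|x| -> f x = 0.

Lemma supported_le r r' f : r <= r' -> supported r f -> supported r' f.
Proof. by move=> rr hf x hx; apply: hf; exact: le_lt_trans hx. Qed.

Lemma supportedM r f g : supported r f -> supported r (fun x => f x * g x).
Proof. by move=> hf x /hf ->; rewrite mul0r. Qed.

Lemma supported_der r f f1 : (forall x, is_derive x 1 f (f1 x)) ->
  supported r f -> supported r f1.
Proof.
move=> df sf x rx; have h : is_derive x 1 f 0.
  apply: (near_eq_is_derive _ (der_cst 0 x)); near=> y; apply/esym/sf; near: y.
  have /cvgrPdist_lt/(_ (`|x| - r)) : `|y| @[y --> x] --> `|x|.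
    by apply: cvg_norm; exact: cvg_id.
  rewrite subr_gt0 => /(_ rx); apply: filterS => y.
  by rewrite ltr_norml => /andP[_]; lra.
by have [_ <-] := df x; have [_ <-] := h.
Unshelve. all: by end_near. Qed.

Lemma supported_restrict r f : supported r f -> f \_ `[- r, r] = f.
Proof.
move=> sf; apply/funext => x; rewrite patchE; case: ifPn => //.
move=> /negP h; apply/esym/sf; rewrite ltNge; apply/negP => h'; apply: h.
by rewrite inE/= in_itv/= -ler_norml.
Qed.

Lemma L1R_supported r f : continuous f -> supported r f -> L1R f.
Proof.
move=> cf sf; rewrite /L1R -(supported_restrict sf) -restrict_EFin.
apply/(integrable_mkcond _ _).1 => //.
apply: continuous_compact_integrable; first exact: segment_compact.
exact: continuous_subspaceT.
Qed.

Lemma Rint_supported r f : supported r f ->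
  \int[mu]_x f x = \int[mu]_(x in `[- r, r]) f x.
Proof.
move=> sf; rewrite [RHS]Rintegral_mkcond; apply: eq_Rintegral => x _.
by have := congr1 (fun g => g x) (supported_restrict sf).
Qed.

Lemma norm_Rint_supported r f (M : R) : 0 <= r -> continuous f -> supported r f ->
  (forall x, `|f x| <= M) -> `|\int[mu]_x f x| <= 2 * r * M.
Proof.
move=> r0 cf sf fM; have hf := L1R_supported cf sf.
apply: (le_trans (norm_Rint hf)).
rewrite (@Rint_supported r); last by move=> x /sf ->; rewrite normr0.
have rr : - r <= r by lra.
have hc : mu.-integrable `[- r, r] (EFin \o (fun=> M)).
  apply: continuous_compact_integrable; first exact: segment_compact.
  by apply: continuous_subspaceT => x; exact: cvg_cst.
have -> : 2 * r * M = \int[mu]_(x in `[- r, r]) (fun=> M) x.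
  rewrite Rintegral_cst//= lebesgue_measure_itv/= lte_fin.
  case: ifPn => [_ /=|]; first by ring.
  rewrite -leNgt fine0 => h; have r00 : r = 0 by lra.
  by rewrite r00; ring.
apply: (@le_Rintegral _ _ _ mu _ (fun x => `|f x|) (fun=> M)) => //.
by apply: integrableS (L1R_norm hf).
Qed.

Lemma FTC_segment (F f : R -> R) (a b : R) : a < b ->
  (forall x, is_derive x 1 F (f x)) -> continuous f ->
  \int[mu]_(x in `[a, b]) f x = F b - F a.
Proof.
move=> ab dF cf; rewrite /Rintegral (@continuous_FTC2 _ f F)//.
- exact: continuous_subspaceT.
- have cF x : {for x, continuous F} := der_continuous (dF x).
  split; first by move=> x _; have [] := dF x.
    by apply: cvg_at_right_filter; exact: cF.
  by apply: cvg_at_left_filter; exact: cF.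
- by move=> x _; rewrite derive1E; have [_ ->] := dF x.
Qed.

(** The cosine transform for [th = 0] and the sine transform for [th = - (pi / 2)]; other phases
    arise when [G] is translated. *)
Definition osc th G t := \int[mu]_x (G x * cos (t * x + th)).

Lemma cont_cosa t th : continuous (fun x : R => cos (t * x + th)).
Proof. by move=> x; exact: der_continuous (der_cosa t th x). Qed.

Lemma continuousM (f g : R -> R) : continuous f -> continuous g ->
  continuous (fun x => f x * g x).
Proof. by move=> cf cg x; apply: cvgM; [exact: cf|exact: cg]. Qed.

Lemma cos_norm_le1 (x : R) : `|cos x| <= 1.
Proof. by rewrite ler_norml cos_geN1 cos_le1. Qed.

Lemma sin_norm_le1 (x : R) : `|sin x| <= 1.
Proof. by rewrite ler_norml sin_geN1 sin_le1. Qed.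

Lemma norm_mul_cos G (M x t th : R) : `|G x| <= M -> `|G x * cos (t * x + th)| <= M.
Proof.
move=> GM; rewrite normrM (le_trans _ GM)//.
by rewrite -[leRHS]mulr1 ler_wpM2l// cos_norm_le1.
Qed.

Lemma osc_by_parts G G1 G2 r th t : C2 G G1 G2 -> supported r G -> 0 <= r ->
  t ^+ 2 * osc th G t = - osc th G2 t.
Proof.
move=> CG sG r0; have cG := C2_cont CG; have [dG dG1 cG2] := CG.
have sG1 := supported_der dG sG; have sG2 := supported_der dG1 sG1.
have cc := @cont_cosa t th.
have i0 : L1R (fun x => G x * cos (t * x + th)).
  by apply: (@L1R_supported r); [exact: continuousM|exact: supportedM].
have i2 : L1R (fun x => G2 x * cos (t * x + th)).
  by apply: (@L1R_supported r); [exact: continuousM|exact: supportedM].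
apply/eqP; rewrite -addr_eq0 /osc -RintZ// -RintD//; last exact: L1RZ.
(* At [r] itself [supported] says nothing, and the interval must not degenerate when [r = 0]. *)
rewrite (@Rint_supported (r + 1)); last first.
  by move=> x hx; rewrite sG ?sG2 ?mul0r ?mulr0 ?addr0//; lra.
(* An explicit primitive of the sum of both integrands, which performs the two integrations by parts
   at once and vanishes at both ends. *)
pose F x := t * (G x * sin (t * x + th)) + G1 x * cos (t * x + th).
pose f x := t ^+ 2 * (G x * cos (t * x + th)) + G2 x * cos (t * x + th).
have dF x : is_derive x 1 F (f x).
  apply: (is_derive_eq (derD (derZ t (derM (dG x) (der_sina t th x)))
    (derM (dG1 x) (der_cosa t th x)))); rewrite /f; ring.
have cf : continuous f.
  move=> x; apply: cvgD; last exact: (continuousM cG2 cc).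
  by apply: cvgM; [exact: cvg_cst|exact: (continuousM cG cc)].
have ab : - (r + 1) < r + 1 by lra.
have r1 : r < `|r + 1| by rewrite ger0_norm; lra.
have r2 : r < `|- (r + 1)| by rewrite normrN.
by rewrite (FTC_segment ab dF cf) /F !(sG1, sG)// !mul0r !mulr0 addr0 subr0.
Qed.

Definition wt (t : R) : R := (1 + t ^+ 2)^-1.

Lemma wt_den_gt0 t : 0 < 1 + t ^+ 2 :> R.
Proof. by rewrite ltr_pwDl// sqr_ge0. Qed.

Lemma wt_gt0 t : 0 < wt t.
Proof. by rewrite invr_gt0 wt_den_gt0. Qed.

Lemma osc_decay G G1 G2 r th t (M : R) : C2 G G1 G2 -> supported r G -> 0 <= r ->
  (forall x, `|G x| <= M) -> (forall x, `|G2 x| <= M) ->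
  `|osc th G t| <= 4 * r * M * wt t.
Proof.
move=> CG sG r0 GM G2M; have cG := C2_cont CG; have [dG dG1 cG2] := CG.
have sG2 := supported_der dG1 (supported_der dG sG).
have b0 : `|osc th G t| <= 2 * r * M.
  apply: norm_Rint_supported => //.
  - by apply: continuousM => //; exact: cont_cosa.
  - exact: supportedM.
  - by move=> x; exact: norm_mul_cos.
have b2 : `|osc th G2 t| <= 2 * r * M.
  apply: norm_Rint_supported => //.
  - by apply: continuousM => //; exact: cont_cosa.
  - exact: supportedM.
  - by move=> x; exact: norm_mul_cos.
rewrite /wt ler_pdivlMr ?wt_den_gt0//.
have := osc_by_parts th t CG sG r0 => /(congr1 (fun z => `|z|)).
rewrite normrN normrM (ger0_norm (sqr_ge0 t)) => e.
by rewrite mulrDr mulr1 [X in _ + X]mulrC e; lra.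
Qed.

Lemma continuous_supported_bounded f (r : R) : 0 <= r -> continuous f -> supported r f ->
  exists2 M : R, 0 <= M & forall x, `|f x| <= M.
Proof.
move=> r0 cf sf; have rr : - r <= r by lra.
have cn : {within `[- r, r], continuous (fun x => `|f x|)}.
  by apply: continuous_subspaceT => x; apply: cvg_norm; exact: cf.
have [c _ Hc] := EVT_max rr cn.
exists `|f c| => // x; have [rx|xr] := ltP r `|x|; first by rewrite sf// normr0.
by apply: Hc; rewrite in_itv/= -ler_norml.
Qed.

Lemma smooth2_bounded G r : smooth2 G -> supported r G -> 0 <= r ->
  exists G1 G2, exists2 M : R, 0 <= M &
    C2 G G1 G2 /\ forall x, [/\ `|G x| <= M, `|G1 x| <= M & `|G2 x| <= M].
Proof.
move=> [G1 [G2 CG]] sG r0; have cG1 := C2_cont1 CG; have cG := C2_cont CG.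
have [dG dG1 cG2] := CG.
have sG1 := supported_der dG sG; have sG2 := supported_der dG1 sG1.
have [M0 M00 H0] := continuous_supported_bounded r0 cG sG.
have [M1 M10 H1] := continuous_supported_bounded r0 cG1 sG1.
have [M2 M20 H2] := continuous_supported_bounded r0 cG2 sG2.
exists G1, G2, (M0 + M1 + M2); first by rewrite !addr_ge0.
by split=> // x; have := H0 x; have := H1 x; have := H2 x; split; lra.
Qed.

Lemma osc_decay_smooth2 G r : smooth2 G -> supported r G -> 0 <= r ->
  exists2 C : R, 0 <= C & forall th t, `|osc th G t| <= C * wt t.
Proof.
move=> hG sG r0; have [G1 [G2 [M M0 [CG b]]]] := smooth2_bounded hG sG r0.
exists (4 * r * M); first by rewrite !mulr_ge0.
by move=> th t; apply: (osc_decay _ _ CG) => // x; have [] := b x.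
Qed.

Lemma L1R_wt : L1R wt.
Proof.
have cw : continuous wt.
  move=> x; apply: cvgV; first by rewrite gt_eqF ?wt_den_gt0.
  by apply: cvgD; [exact: cvg_cst|exact: exprn_continuous].
have w0 x : 0 <= wt x by exact/ltW/wt_gt0.
apply/integrableP; split; first by apply/measurable_EFinP; exact: continuous_measurable_fun.
under eq_integral do rewrite /= ger0_norm//.
rewrite ge0_symfun_integralT//; last by move=> x; rewrite /wt /= sqrrN.
rewrite -set_itvcy (_ : (\int[_]_(x in _) _)%E = (pi / 2)%:E) ?ltry//.
exact: integral0y_oneDsqr.
Qed.

Lemma wt_shift t a : wt (t - a) <= 2 * (1 + a ^+ 2) * wt t.
Proof.
rewrite /wt ler_pdivlMr ?wt_den_gt0// mulrC ler_pdivrMr ?wt_den_gt0//.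
(* The difference of the two sides, cleared of denominators, is 1 plus this sum of squares. *)
have : 0 <= (t - 2 * a) ^+ 2 + (a * (t - a)) ^+ 2 *+ 2 by rewrite addr_ge0 ?mulrn_wge0 ?sqr_ge0.
nra.
Qed.

Lemma L1R_outside (B : R) f : L1R f -> L1R (fun x => if `|x| <= B then 0 else `|f x|).
Proof.
move=> hf; have mf := L1R_measurable hf.
apply: le_L1R (L1R_norm hf) => [|x]; last by case: ifP => _; rewrite ?normr0// normr_id.
apply: measurable_fun_ifT => //=; last exact: measurableT_comp.
by apply: measurable_fun_ler => //; exact: normr_measurable.
Qed.

Lemma L1R_tail f (d : R) : L1R f -> 0 < d -> exists2 A : R, 0 < A & forall B, A <= B ->
  \int[mu]_x (if `|x| <= B then 0 else `|f x|) <= d.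
Proof.
move=> hf d0; pose F n := fun x => if `|x| <= n%:R then 0 else `|f x| : R.
have iF (B : R) := L1R_outside B hf.
have mF (B : R) := L1R_measurable (iF B).
have F0 : {ae mu, forall x, setT x -> (EFin \o F n) x @[n --> \oo] --> (cst 0%E : R -> \bar R) x}.
  apply/aeW => x _; apply: cvg_near_cst; near=> n.
  rewrite /= /F ifT// ltW// (lt_le_trans (truncnS_gt _))// ler_nat.
  by near: n; exact: nbhs_infty_ge.
pose af (x : R) : R := `|f x|.
have Fle : {ae mu, forall x n, setT x -> (`|(EFin \o F n) x| <= (EFin \o af) x)%E}.
  by apply/aeW => x n _ /=; rewrite lee_fin /F /af; case: ifP => _; rewrite ?normr0 ?normr_id.
have mFE n : measurable_fun setT (EFin \o F n) by apply/measurable_EFinP; exact: mF.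
have := @dominated_convergence _ _ R mu setT measurableT (fun n => EFin \o F n)
  (cst 0%E) (EFin \o af) mFE (measurable_cst _) F0 (L1R_norm hf) Fle.
case=> _ _.
rewrite integral0 => /fine_cvgP[_] /cvgrPdist_le /(_ _ d0)[N _ HN].
exists N.+1%:R => // B NB.
have := HN N.+1 (leqnSn N); rewrite sub0r normrN => /(le_trans (ler_norm _)).
apply: le_trans; apply: (le_Rint (iF B) (iF N.+1%:R)) => x.
have [h|h] := leP `|x| N.+1%:R; first by rewrite ifT ?(le_trans h).
by case: ifP.
Unshelve. all: by end_near. Qed.

End RealIntegral.

(** * Construction of the generator *)

Section Generator.
Variable R : realType.
Notation mu := (@lebesgue_measure R).
Implicit Types (f g G W : R -> R) (x t r th : R) (s : seq (R * R)).

Lemma osc_L1R r G th t : continuous G -> supported r G ->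
  L1R (fun x => G x * cos (t * x + th)).
Proof.
move=> cG sG; apply: (@L1R_supported _ r); last exact: supportedM.
by apply: continuousM => //; exact: cont_cosa.
Qed.

Lemma oscB r G G' th t : continuous G -> supported r G -> continuous G' -> supported r G' ->
  osc th (fun x => G x - G' x) t = osc th G t - osc th G' t.
Proof.
move=> cG sG cG' sG'; rewrite /osc -RintB; [|exact: (osc_L1R _ _ cG sG)|exact: (osc_L1R _ _ cG' sG')].
by apply: eq_Rintegral => x _; rewrite mulrBl.
Qed.

Lemma osc_lincomb r (I : Type) (l : seq I) (c : I -> R) (F : I -> R -> R) th t :
  (forall i, continuous (F i)) -> (forall i, supported r (F i)) ->
  osc th (fun x => \sum_(i <- l) c i * F i x) t = \sum_(i <- l) c i * osc th (F i) t.
Proof.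
move=> cF sF; rewrite /osc.
under eq_Rintegral do rewrite mulr_suml.
rewrite Rint_sum; last first.
  move=> i; under eq_fun do rewrite -mulrA.
  by apply: L1RZ; exact: (osc_L1R _ _ (cF i) (sF i)).
apply: eq_bigr => i _; rewrite -RintZ; last exact: (osc_L1R _ _ (cF i) (sF i)).
by apply: eq_Rintegral => x _; rewrite mulrA.
Qed.

Lemma cos_lipschitz (a b : R) : `|cos a - cos b| <= `|a - b|.
Proof.
wlog ab : a b / a <= b.
  by move=> H; have [/H//|/ltW/H] := leP a b; rewrite distrC [leRHS]distrC.
move: ab; rewrite le_eqVlt => /predU1P[->|ab]; first by rewrite !subrr.
have [c _ e] := mean_value (fun x => is_derive_cos x) ab.
rewrite distrC e normrM [leRHS]distrC -[leRHS]mul1r ler_wpM2r//.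
by rewrite normrN sin_norm_le1.
Qed.

Lemma osc_lipschitz r G : 0 <= r -> smooth2 G -> supported r G ->
  exists2 K : R, 0 <= K & forall th t t', `|osc th G t - osc th G t'| <= K * `|t - t'|.
Proof.
move=> r0 hG sG; have cG := smooth2_continuous hG.
have [G1 [G2 [M M0 [_ GM]]]] := smooth2_bounded hG sG r0.
exists (2 * r * (M * r)); first by rewrite !mulr_ge0.
move=> th t t'; rewrite /osc -RintB; [|exact: (osc_L1R _ _ cG sG)..].
rewrite -!mulrA [2 * _]mulrA.
apply: norm_Rint_supported => //.
- move=> x; apply: cvgB; apply: continuousM => //; exact: cont_cosa.
- by move=> x /sG ->; rewrite !mul0r subrr.
- move=> x; rewrite -mulrBr normrM; have [GMx _ _] := GM x.
  have [rx|xr] := ltP r `|x|; first by rewrite sG// normr0 mul0r !mulr_ge0.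
  apply: ler_pM => //; apply: (le_trans (cos_lipschitz _ _)).
  rewrite (_ : _ - _ = x * (t - t')); last by ring.
  by rewrite normrM ler_wpM2r.
Qed.

(* Supported on [n ^ 2 - 1 <= x ^ 2 <= (n + 1) ^ 2]; unlike [(n - 1) ^ 2], the
   lower end [n ^ 2 - 1] is also correct for [n = 0]. *)
Definition bump (n : nat) x : R :=
  pos3 ((x ^+ 2 - n%:R ^+ 2 + 1) * ((n%:R + 1) ^+ 2 - x ^+ 2)).

Lemma smooth2_sqr : smooth2 (fun x : R => x ^+ 2).
Proof.
have h : smooth2 (fun x : R => x).
  by have := smooth2_affine (1 : R) 0; under eq_fun do rewrite mul1r addr0.
by have := smooth2M h h.
Qed.

Lemma smooth2_bump n : smooth2 (bump n).
Proof.
apply: smooth2_pos3; apply: smooth2M; last first.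
  by apply: smooth2B; [exact: smooth2_cst|exact: smooth2_sqr].
apply: smooth2D; last exact: smooth2_cst.
by apply: smooth2B; [exact: smooth2_sqr|exact: smooth2_cst].
Qed.

Lemma bumpN n x : bump n (- x) = bump n x.
Proof. by rewrite /bump sqrrN. Qed.

Lemma bump_ge0 n x : 0 <= bump n x. Proof. exact: pos3_ge0. Qed.

Lemma sqr_norm x : x ^+ 2 = `|x| ^+ 2. Proof. by rewrite real_normK ?num_real. Qed.

Lemma supported_bump n : supported (n%:R + 1) (bump n).
Proof.
move=> x nx; apply: pos3_eq0; rewrite sqr_norm.
have n0 := ler0n R n; apply: mulr_ge0_le0; nra.
Qed.

Lemma bump_gt0 n x : n%:R <= `|x| < n%:R + 1 -> 0 < bump n x.
Proof.
move=> /andP[nx xn]; apply: pos3_gt0; rewrite sqr_norm.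
have n0 := ler0n R n; apply: mulr_gt0; nra.
Qed.

Definition atom n t := osc 0 (bump n) t.

(** A function of the list of coefficients, because the next coefficient will be computed from this
    list alone. *)
Definition weight (p : seq R) x := \sum_(n <- iota 0 (size p)) nth 0 p n * bump n x.

Lemma smooth2_sum (I : Type) (l : seq I) (F : I -> R -> R) :
  (forall i, smooth2 (F i)) -> smooth2 (fun x => \sum_(i <- l) F i x).
Proof.
move=> hF; elim: l => [|i l IH].
  by under eq_fun do rewrite big_nil; exact: smooth2_cst.
by under eq_fun do rewrite big_cons; exact: smooth2D.
Qed.

Lemma smooth2_weight p : smooth2 (weight p).
Proof.
apply: smooth2_sum => n; apply: smooth2M; first exact: smooth2_cst.
exact: smooth2_bump.
Qed.

Lemma weightN p x : weight p (- x) = weight p x.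
Proof. by apply: eq_bigr => n _; rewrite bumpN. Qed.

Lemma supported_weight p : supported (size p)%:R (weight p).
Proof.
move=> x px; rewrite /weight big_seq big1// => n; rewrite mem_iota add0n => /andP[_ np].
rewrite supported_bump ?mulr0//; apply: le_lt_trans px.
by rewrite natr1 ler_nat.
Qed.

Lemma weight_ge0 p x : all (fun y => 0 < y) p -> 0 <= weight p x.
Proof.
move=> /(all_nthP 0) pp; rewrite /weight big_seq sumr_ge0// => n.
by rewrite mem_iota add0n => /andP[_ /pp/ltW h]; rewrite mulr_ge0// bump_ge0.
Qed.

(** The bump whose index is the integer part of [|x|] is positive at [x], and no other term is
    negative. *)
Lemma weight_gt0 p (N : nat) x : all (fun y => 0 < y) p -> (N < size p)%N ->
  `|x| <= N%:R -> 0 < weight p x.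
Proof.
move=> pp Np xN; have /truncn_itv := normr_ge0 x; set k := Num.truncn _.
rewrite -natr1 => kx; have kN : (k <= N)%N.
  rewrite -(ler_nat R); case/andP: kx => kx _; exact: le_trans xN.
have kp : (k < size p)%N by exact: leq_ltn_trans Np.
have hk : 0 < nth 0 p k * bump k x.
  by rewrite mulr_gt0 ?bump_gt0//; move/(all_nthP 0) : pp; apply.
rewrite /weight (bigD1_seq k) ?iota_uniq ?mem_iota//= ltr_pwDl// big_seq_cond.
rewrite sumr_ge0// => n; rewrite mem_iota add0n => /andP[/andP[_ np] _].
by rewrite mulr_ge0 ?bump_ge0// ltW//; move/(all_nthP 0) : pp; apply.
Qed.

Definition comb (phi : R -> R) s t := \sum_(p <- s) p.1 * phi (t - p.2).

(** The addition formula for [cos ((t - lam) * x)]: on the transform side, translating multiplies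
    [W] by cosines and sines with the same coefficients. *)
Lemma comb_osc r W s t : continuous W -> supported r W ->
  comb (osc 0 W) s t = osc 0 (fun x => W x * cos_sum 0 s x) t +
    osc (- (pi / 2)) (fun x => W x * cos_sum (- (pi / 2)) s x) t.
Proof.
move=> cW sW.
have e th t' : osc th (fun x => W x * cos_sum th s x) t' =
    \sum_(p <- s) p.1 * osc th (fun x => W x * cos (p.2 * x + th)) t'.
  rewrite -(@osc_lincomb r); first last.
  - by move=> p; exact: supportedM.
  - by move=> p; apply: continuousM => //; exact: cont_cosa.
  rewrite /osc; apply: eq_Rintegral => x _; congr (_ * _).
  by rewrite /cos_sum mulr_sumr; apply: eq_bigr => p _; ring.
rewrite !e -big_split/=; apply: eq_bigr => p _; rewrite -mulrDr; congr (_ * _).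
have cc th q : continuous (fun x => W x * cos (q * x + th)).
  by apply: continuousM => //; exact: cont_cosa.
have sc th q : supported r (fun x => W x * cos (q * x + th)) by exact: supportedM.
rewrite /osc -RintD; [|exact: (osc_L1R _ _ (cc _ _) (sc _ _))..].
apply: eq_Rintegral => x _; rewrite -!mulrA -mulrDr; congr (_ * _).
by rewrite !addr0 !cosBpihalf mulrBl cosB mulrC; congr (_ + _); rewrite mulrC.
Qed.

(* The term added to [W] in the denominator vanishes where [Psi] does not. *)
Lemma weight_division W (N : R) : 0 <= N -> smooth2 W -> (forall x, 0 <= W x) ->
  (forall x, `|x| <= N -> 0 < W x) -> (forall x, W (- x) = W x) ->
  exists V : R -> R, [/\ smooth2 V, forall x, V (- x) = V x &
    forall (Psi : R -> R) x, supported N Psi -> W x * (Psi x * V x) = Psi x].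
Proof.
move=> N0 hW W0 Wpos We.
pose Z x := pos3 (x ^+ 2 - N ^+ 2).
have Z0 x : `|x| <= N -> Z x = 0.
  by move=> xN; apply: pos3_eq0; rewrite sqr_norm; have := normr_ge0 x; nra.
have U0 x : 0 < W x + Z x.
  have [xN|Nx] := leP `|x| N; first by rewrite ltr_pwDl ?Wpos ?pos3_ge0.
  rewrite ltr_wpDl//; apply: pos3_gt0; rewrite sqr_norm; nra.
exists (fun x => (W x + Z x)^-1); split.
- apply: smooth2V; first by move=> x; rewrite gt_eqF.
  apply: smooth2D => //; apply: smooth2_pos3; apply: smooth2B; first exact: smooth2_sqr.
  exact: smooth2_cst.
- by move=> x; rewrite We /Z sqrrN.
- move=> Psi x sP; have [xN|Nx] := leP `|x| N; last by rewrite sP// mul0r mulr0.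
  by rewrite Z0// addr0 mulrCA divff ?mulr1// gt_eqF// Wpos.
Qed.

Lemma osc_product_small W W1 W2 r (M d : R) e e1 e2 th t : C2 W W1 W2 ->
  supported r W -> 0 <= r -> 0 <= d ->
  (forall x, [/\ `|W x| <= M, `|W1 x| <= M & `|W2 x| <= M]) -> C2 e e1 e2 ->
  (forall x, `|x| <= r -> [/\ `|e x| <= d, `|e1 x| <= d & `|e2 x| <= d]) ->
  `|osc th (fun x => W x * e x) t| <= 16 * r * M * d * wt t.
Proof.
move=> CW sW r0 d0 WM Ce ed; have M0 : 0 <= M by have [h _ _] := WM 0; exact: le_trans h.
have sW1 := supported_der (C2_d1 CW) sW; have sW2 := supported_der (C2_d2 CW) sW1.
(* The outer 4 is the constant of [osc_decay]; the inner one adds up the Leibniz terms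
   [W2 e + 2 W1 e1 + W e2]. *)
have -> : 16 * r * M * d * wt t = 4 * r * (4 * (M * d)) * wt t by ring.
have Md : 0 <= M * d by rewrite mulr_ge0.
apply: (osc_decay _ _ (C2M CW Ce)) => //; first exact: supportedM.
- move=> x; have [xr|rx] := leP `|x| r; last by rewrite sW// mul0r normr0 mulr_ge0.
  have [a _ _] := WM x; have [b _ _] := ed x xr.
  rewrite normrM; apply: le_trans (ler_pM _ _ a b) _ => //; lra.
- move=> x; have [xr|rx] := leP `|x| r; last first.
    by rewrite sW// sW1// sW2// !mul0r mulr0 !addr0 normr0 mulr_ge0.
  have [a0 a1 a2] := WM x; have [b0 b1 b2] := ed x xr.
  apply: (le_trans (ler_normD _ _)); rewrite normrM.
  have h1 := ler_pM (normr_ge0 _) (normr_ge0 _) a0 b2.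
  have h2 := ler_pM (normr_ge0 _) (normr_ge0 _) a1 b1.
  have h3 := ler_pM (normr_ge0 _) (normr_ge0 _) a2 b0.
  have h4 := ler_normD (W2 x * e x) (2 * (W1 x * e1 x)).
  move: h4; rewrite !normrM (ger0_norm (_ : 0 <= 2))// => h4; lra.
Qed.

(** For even [Psi1] and odd [Psi2] this is the integral of [(Psi1 + i Psi2) e^(- i t x)] over [x],
    whose imaginary part vanishes: an inverse Fourier transform up to a constant. These parities are
    also what [exp_complete_cos_sum] asks for. *)
Definition target (Psi1 Psi2 : R -> R) t := osc 0 Psi1 t + osc (- (pi / 2)) Psi2 t.

Record admissible (Psi1 Psi2 : R -> R) (N : R) : Prop := {
  adm_s1 : smooth2 Psi1 ; adm_s2 : smooth2 Psi2 ;
  adm_even : forall x, Psi1 (- x) = Psi1 x ;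
  adm_odd : forall x, Psi2 (- x) = - Psi2 x ;
  adm_supp1 : supported N Psi1 ; adm_supp2 : supported N Psi2 }.

Lemma stage_approx (L : set R) W (Psi1 Psi2 : R -> R) (N r d : R) :
  (forall rho : R, exp_complete L rho) -> 0 <= N <= r -> 0 < d ->
  smooth2 W -> supported r W -> (forall x, 0 <= W x) ->
  (forall x, `|x| <= N -> 0 < W x) -> (forall x, W (- x) = W x) ->
  admissible Psi1 Psi2 N ->
  exists s, (forall p, p \in s -> L p.2) /\
    forall t, `|comb (osc 0 W) s t - target Psi1 Psi2 t| <= d * wt t.
Proof.
move=> HL /andP[N0 Nr] d0 hW sW W0 Wpos We [h1 h2 e1 o2 s1 s2].
have r0 : 0 <= r by exact: le_trans Nr.
have [V [hV Ve HV]] := weight_division N0 hW W0 Wpos We.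
have [f1 [f2 Cf]] := smooth2M h1 hV; have [g1 [g2 Cg]] := smooth2M h2 hV.
have [W1 [W2 [M M0 [CW WM]]]] := smooth2_bounded hW sW r0.
(* The cosine and the sine part each cost [16 * r * M * dd]; the added 1 keeps the denominator
   positive. *)
pose dd := d / (32 * r * M + 1).
have dd0 : 0 < dd by rewrite divr_gt0// ltr_wpDl// !mulr_ge0.
have ddle : 32 * r * M * dd <= d.
  have : (32 * r * M + 1) * dd = d by rewrite /dd; field; rewrite gt_eqF// ltr_wpDl// !mulr_ge0.
  lra.
have [||s [sL Hs]] := exp_complete_C2 r HL Cf Cg _ _ dd0.
- by move=> x; rewrite e1 Ve.
- by move=> x; rewrite o2 Ve mulNr.
exists s; split => // t; rewrite (comb_osc s t (smooth2_continuous hW) sW) /target.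
have E th (Psi : R -> R) : smooth2 Psi -> supported N Psi ->
    osc th (fun x => W x * cos_sum th s x) t - osc th Psi t =
    osc th (fun x => W x * (cos_sum th s x - Psi x * V x)) t.
  move=> hP sP; rewrite -(@oscB r); first last.
  - exact: supported_le sP.
  - exact: smooth2_continuous.
  - exact: supportedM.
  - apply: continuousM; first exact: smooth2_continuous.
    exact: C2_cont (C2_cos_sum th s).
  rewrite /osc; apply: eq_Rintegral => x _; congr (_ * _).
  by rewrite mulrBr HV.
rewrite opprD addrACA !E//; apply: (le_trans (ler_normD _ _)).
have b1 := osc_product_small 0 t CW sW r0 (ltW dd0) WM
  (C2B (C2_cos_sum 0 s) Cf) (fun x xr => (Hs x xr).1).
have b2 := osc_product_small (- (pi / 2)) t CW sW r0 (ltW dd0) WM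
  (C2B (C2_cos_sum (- (pi / 2)) s) Cg) (fun x xr => (Hs x xr).2).
apply: (le_trans (lerD b1 b2)).
rewrite -mulrDl ler_wpM2r ?(ltW (wt_gt0 _))//; lra.
Qed.

(** Course-of-values recursion, by which [eps n] can depend on the approximations selected for the
    earlier coefficients. *)
Lemma prefix_recursion (F : seq R -> R) : exists eps : nat -> R,
  forall n, eps n = F (mkseq eps n).
Proof.
pose p := fix p n := if n is m.+1 then rcons (p m) (F (p m)) else [::].
exists (fun n => F (p n)) => n; congr F; elim: n => // n IH.
by rewrite mkseqS -IH.
Qed.

End Generator.

Section GeneratorConstruction.
Variable R : realType.
Implicit Types (s : seq (R * R)) (t : R) (u : nat -> R).

Definition geo (k : nat) : R := 2^-1 ^+ k.

Lemma geo_gt0 k : 0 < geo k. Proof. by rewrite exprn_gt0// invr_gt0. Qed.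

Lemma geo_tail u (K : R) (n m : nat) : 0 <= K ->
  (forall k, (n <= k)%N -> `|u k| <= K * geo k) -> (n <= m)%N ->
  `|series u m - series u n| <= 2 * K * geo n.
Proof.
move=> K0 uK nm; apply: (@le_trans _ _ (2 * K * (geo n - geo m))); last first.
  rewrite ler_wpM2l ?mulr_ge0//; have := geo_gt0 m; lra.
elim: m nm => [|m IH]; first by rewrite leqn0 => /eqP->; rewrite !subrr normr0 mulr0.
rewrite leq_eqVlt => /predU1P[<-|]; first by rewrite !subrr normr0 mulr0.
rewrite ltnS => nm; have h := IH nm; have um := uK m nm.
have -> : series u m.+1 - series u n = (series u m - series u n) + u m.
  by rewrite /series/= big_nat_recr//=; ring.
apply: (le_trans (ler_normD _ _)).
have -> : geo m.+1 = geo m / 2 by rewrite /geo exprS mulrC.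
lra.
Qed.

Lemma geo_small (d : R) : 0 < d -> exists n0 : nat, forall n, (n0 <= n)%N -> geo n < d.
Proof.
move=> d0; have : geo @ \oo --> (0 : R).
  by apply: cvg_expr; rewrite ger0_norm; lra.
move=> /cvgrPdist_lt/(_ _ d0)[N _ HN]; exists N => n /HN.
by rewrite sub0r normrN ger0_norm// ltW// geo_gt0.
Qed.

Lemma geo_cvg u (K : R) : 0 <= K -> (forall k, `|u k| <= K * geo k) -> cvgn (series u).
Proof.
move=> K0 uK; apply: normed_cvg.
apply: (@series_le_cvg _ _ (fun k => K * geo k)).
- by move=> n /=.
- by move=> n; apply: mulr_ge0 => //; apply: ltW; exact: geo_gt0.
- exact: uK.
- by apply: is_cvg_geometric_series; rewrite ger0_norm; lra.
Qed.

(** [K] serves for convergence; the estimate itself uses the better constant [K'] of the late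
    terms. *)
Lemma geo_lim u (K K' : R) (n : nat) : 0 <= K -> 0 <= K' ->
  (forall k, `|u k| <= K * geo k) -> (forall k, (n <= k)%N -> `|u k| <= K' * geo k) ->
  `|limn (series u) - series u n| <= 2 * K' * geo n.
Proof.
move=> K0 K'0 uK uK'; have cu := geo_cvg K0 uK.
have cv : `|series u m - series u n| @[m --> \oo] --> `|limn (series u) - series u n|.
  by apply: cvg_norm; apply: cvgB => //; exact: cvg_cst.
rewrite -(cvg_lim (@Rhausdorff R) cv); apply: limr_le; first by apply/cvg_ex; eexists; exact: cv.
by near=> m; apply: geo_tail => //; near: m; exact: nbhs_infty_ge.
Unshelve. all: by end_near. Qed.

(** A bound for the operator [comb _ s] in the norm weighted by [wt]; the factor of each translation
    is that of [wt_shift]. *)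
Definition mass s : R := \sum_(p <- s) `|p.1| * (2 * (1 + p.2 ^+ 2)).

Lemma mass_ge0 s : 0 <= mass s.
Proof. by apply: sumr_ge0 => p _; rewrite mulr_ge0// mulr_ge0// addr_ge0// sqr_ge0. Qed.

Lemma comb_wt (f : R -> R) s (K t : R) : (forall x, `|f x| <= K * wt x) -> 0 <= K ->
  `|comb f s t| <= K * mass s * wt t.
Proof.
move=> fK K0; apply: (le_trans (ler_norm_sum _ _ _)).
rewrite /mass mulr_sumr mulr_suml; apply: ler_sum => p _; rewrite normrM.
have h1 := fK (t - p.2); have h2 := wt_shift t p.2.
have -> : K * (`|p.1| * (2 * (1 + p.2 ^+ 2))) * wt t =
   `|p.1| * (K * (2 * (1 + p.2 ^+ 2) * wt t)) by ring.
by rewrite ler_wpM2l//; apply: (le_trans h1); rewrite ler_wpM2l.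
Qed.

End GeneratorConstruction.

(** * Choice of the coefficients *)

Section GeneratorExists.
Variable R : realType.
Variables (L : set R) (Psi1 Psi2 : nat -> R -> R) (N : nat -> nat).
Hypothesis HL : forall rho : R, exp_complete L rho.
Hypothesis adm : forall j, admissible (Psi1 j) (Psi2 j) (N j)%:R.

Lemma osc_weight (p : seq R) t : osc 0 (weight p) t =
  \sum_(n <- iota 0 (size p)) nth 0 p n * atom n t.
Proof.
have ei : iota 0 (size p) = index_iota 0 (size p) by rewrite /index_iota subn0.
rewrite /weight.
have -> : (fun x : R => \sum_(n <- iota 0 (size p)) nth 0 p n * bump n x) =
          (fun x : R => \sum_(n : 'I_(size p)) nth 0 p n * bump n x).
  by apply/funext => x; rewrite ei big_mkord.
rewrite ei big_mkord.
rewrite (@osc_lincomb _ ((size p)%:R + 1)) //.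
- by move=> i; exact: smooth2_continuous (@smooth2_bump R i).
- move=> i; apply: supported_le (@supported_bump R i).
  by rewrite lerD2r ler_nat ltnW.
Qed.

Theorem generator_exists : exists phi : R -> R,
  [/\ continuous phi, exists K : R, forall t, `|phi t| <= K * wt t &
    forall j (d : R), 0 < d -> exists s, (forall p, p \in s -> L p.2) /\
      forall t, `|comb phi s t - target (Psi1 j) (Psi2 j) t| <= d * wt t].
Proof.
have /choice[D HD] : forall n, exists D : R, [/\ 1 <= D,
    forall t, `|atom n t| <= D * wt t &
    forall t t', `|atom n t - atom n t'| <= D * `|t - t'| ].
  move=> n.
  have r0 : 0 <= n%:R + 1 :> R by rewrite addr_ge0.
  have [C C0 HC] := osc_decay_smooth2 (@smooth2_bump R n) (@supported_bump R n) r0.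
  have [K K0 HK] := osc_lipschitz r0 (@smooth2_bump R n) (@supported_bump R n).
  exists (1 + C + K); split; first by lra.
  - by move=> t; apply: (le_trans (HC 0 t)); rewrite ler_wpM2r ?(ltW (wt_gt0 _))//; lra.
  - by move=> t t'; apply: (le_trans (HK 0 t t')); rewrite ler_wpM2r//; lra.
have D0 n : 0 < D n by have [h _ _] := HD n; exact: lt_le_trans h.
(* The selection is made for arbitrary lists, before any coefficient exists. The length of the list
   sets the tolerance. *)
have /choice[sel Hsel] : forall pj : seq R * nat, exists s,
    all (fun y => 0 < y) pj.1 -> (N pj.2 < size pj.1)%N ->
    (forall p, p \in s -> L p.2) /\
    forall t, `|comb (osc 0 (weight pj.1)) s t - target (Psi1 pj.2) (Psi2 pj.2) t|
       <= geo R (size pj.1) * wt t.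
  move=> -[p j] /=.
  have [pp|] := boolP (all (fun y : R => 0 < y) p); last by exists [::].
  have [Np|] := boolP (N j < size p)%N; last by exists [::].
  have [||||||||s Hs] := @stage_approx R L (weight p) (Psi1 j) (Psi2 j) (N j)%:R
    (size p)%:R (geo R (size p)) HL; last by exists s.
  - by rewrite ler0n ler_nat ltnW.
  - exact: geo_gt0.
  - exact: smooth2_weight.
  - exact: supported_weight.
  - by move=> x; exact: weight_ge0.
  - by move=> x; exact: weight_gt0.
  - exact: weightN.
  - exact: adm.
(* Runs over the combinations selected for all prefixes of [p] and all targets of index at most
   [size p]: finitely many, so the next coefficient can be small against every one of them. *)
pose Mass (p : seq R) : R := \sum_(i < (size p).+1) \sum_(j < (size p).+1)
  mass (sel (take i p, val j)).
have Mass0 p : 0 <= Mass p by apply: sumr_ge0 => i _; apply: sumr_ge0 => j _; exact: mass_ge0.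
pose F (p : seq R) : R := geo R (size p) / (D (size p) * (1 + Mass p)).
have [eps Heps] := prefix_recursion F.
have eps0 n : 0 < eps n.
  by rewrite Heps /F divr_gt0 ?geo_gt0// mulr_gt0 ?D0// ltr_pwDl.
have epsD n : eps n * D n * (1 + Mass (mkseq eps n)) = geo R n.
  rewrite {1}Heps /F size_mkseq; field.
  by rewrite !gt_eqF ?D0//= ltr_pwDl.
have eps1 n : eps n * D n <= geo R n.
  by rewrite -(epsD n) ler_peMr ?lerDl// mulr_ge0// ltW.
have epsmass n i j : (i <= n)%N -> (j <= n)%N ->
    eps n * D n * (1 + mass (sel (mkseq eps i, j))) <= geo R n.
  move=> iN jN; rewrite -(epsD n) ler_wpM2l ?mulr_ge0 ?(ltW (eps0 _)) ?(ltW (D0 _))//.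
  rewrite lerD2l /Mass size_mkseq.
  have ti : take i (mkseq eps n) = mkseq eps i by rewrite /mkseq -map_take take_iota (minn_idPl iN).
  rewrite (bigD1 (Ordinal (iN : (i < n.+1)%N)))//= (bigD1 (Ordinal (jN : (j < n.+1)%N)))//=.
  rewrite ti -addrA lerDl addr_ge0//.
    by apply: sumr_ge0 => k _; exact: mass_ge0.
  by apply: sumr_ge0 => k _; apply: sumr_ge0 => l _; exact: mass_ge0.
pose u t k : R := eps k * atom k t.
have ub t k (c : R) : 0 <= c -> eps k * D k * (1 + c) <= geo R k ->
    `|u t k| * (1 + c) <= wt t * geo R k.
  move=> c0 h; rewrite /u normrM (gtr0_norm (eps0 k)).
  have [_ h2 _] := HD k; have {}h2 := h2 t.
  have c1 : 0 <= 1 + c by lra.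
  have w0 := wt_gt0 t; have e0 := eps0 k.
  apply: (@le_trans _ _ (eps k * (D k * wt t) * (1 + c))).
    by rewrite ler_wpM2r// ler_wpM2l// ltW.
  have -> : eps k * (D k * wt t) * (1 + c) = wt t * (eps k * D k * (1 + c)) by ring.
  by rewrite ler_wpM2l// ltW.
have u1 t k : `|u t k| <= wt t * geo R k.
  by rewrite -[leLHS]mulr1 -[X in _ * X]addr0 ub// addr0 mulr1.
pose phi t := limn (series (u t)).
have cu t : cvgn (series (u t)) by exact: geo_cvg (ltW (wt_gt0 t)) (u1 t).
have tail t n (c : R) : 0 <= c ->
    (forall k, (n <= k)%N -> eps k * D k * (1 + c) <= geo R k) ->
    `|phi t - series (u t) n| <= 2 * (wt t / (1 + c)) * geo R n.
  move=> c0 h; apply: (geo_lim (ltW (wt_gt0 t))) => //.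
    by rewrite divr_ge0 ?(ltW (wt_gt0 _))// addr_ge0.
  move=> k nk; rewrite mulrAC ler_pdivlMr ?ltr_pwDl//; exact: ub (h k nk).
exists phi; split.
(* The Lipschitz constants [eps k * D k] of the terms are at most [geo k], whose sum is 2. *)
- have lip t t' : `|phi t - phi t'| <= 2 * `|t - t'|.
    have v1 k : `|u t k - u t' k| <= `|t - t'| * geo R k.
      rewrite /u -mulrBr normrM (gtr0_norm (eps0 k)).
      have [_ _ h] := HD k.
      apply: (@le_trans _ _ (eps k * (D k * `|t - t'|))).
        by rewrite ler_wpM2l// ltW.
      by rewrite mulrA mulrC ler_wpM2l.
    have := geo_lim (n := 0%N) (normr_ge0 _) (normr_ge0 _) v1 (fun k _ => v1 k).
    rewrite {2}/series/= big_geq// subr0 /geo expr0 mulr1.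
    suff -> : series (fun k => u t k - u t' k) = series (u t) - series (u t').
      by rewrite limB.
    by apply/funext => n; rewrite /series/= sumrB.
  move=> t; apply/cvgrPdist_lt => e e0; near=> t'.
  apply: (le_lt_trans (lip t t')); rewrite -ltr_pdivlMl//.
  near: t'; move: (t) => z; have /cvgrPdist_lt := @cvg_id _ (nbhs z).
  by apply; rewrite mulr_gt0// invr_gt0.
- exists 2 => t; have := tail t 0%N 0 (lexx _).
  rewrite /series/= big_geq// subr0 /geo expr0 !mulr1 addr0 divr1; apply => k _.
  by rewrite mulr1; exact: eps1.
- move=> j d d0; have d30 : 0 < d / 3 by rewrite divr_gt0.
  have [n0 Hn0] := geo_small d30.
  (* Past [n0] the error is small; past [j] the mass of the combination for target [j] is respected
     by all later coefficients; past [N j] the partial sum is positive where the target's symbol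
     lives. *)
  pose n := maxn n0 (maxn j (N j).+1).
  have gn : geo R n < d / 3 by apply: Hn0; exact: leq_maxl.
  have jn : (j <= n)%N by rewrite /n !leq_max leqnn orbT.
  have Nn : (N j < n)%N by rewrite /n !leq_max leqnn !orbT.
  pose p := mkseq eps n; pose s := sel (p, j).
  have pp : all (fun y => 0 < y) p by apply/allP => y /mapP[k _ ->]; exact: eps0.
  have [|sL Hs] := Hsel (p, j) pp; first by rewrite size_mkseq.
  exists s; split => // t.
  have sn : osc 0 (weight p) = fun t => series (u t) n.
    apply/funext => t'; rewrite osc_weight size_mkseq /series/= /index_iota subn0.
    rewrite big_seq [RHS]big_seq; apply: eq_bigr => k; rewrite mem_iota add0n => /andP[_ kn].
    by rewrite nth_mkseq.
  (* The division by [1 + mass s] is what remains harmless after the combination [s] is applied to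
     the tail: it then costs at most [2 * geo R n]. *)
  have tl x : `|phi x - osc 0 (weight p) x| <= 2 * geo R n / (1 + mass s) * wt x.
    rewrite sn; have := tail x n _ (mass_ge0 s) => /(_ _)/le_trans; apply.
      by move=> k nk; apply: epsmass => //; exact: leq_trans nk.
    rewrite le_eqVlt; apply/orP; left; apply/eqP; ring.
  have m1 : 0 < 1 + mass s by rewrite ltr_pwDl// mass_ge0.
  have := comb_wt s t tl; rewrite divr_ge0 ?mulr_ge0 ?(ltW m1) ?(ltW (geo_gt0 _ _))// => /(_ isT) h1.
  have e1 : comb (fun x => phi x - osc 0 (weight p) x) s t =
      comb phi s t - comb (osc 0 (weight p)) s t.
    by rewrite /comb -sumrB; apply: eq_bigr => q _; rewrite mulrBr.
  rewrite e1 in h1; have := Hs t; rewrite /= size_mkseq -/s => h2.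
  have -> : comb phi s t - target (Psi1 j) (Psi2 j) t =
    (comb phi s t - comb (osc 0 (weight p)) s t) +
    (comb (osc 0 (weight p)) s t - target (Psi1 j) (Psi2 j) t) by ring.
  apply: (le_trans (ler_normD _ _)); apply: (le_trans (lerD h1 h2)).
  rewrite -mulrDl ler_wpM2r ?(ltW (wt_gt0 _))//.
  have : 2 * geo R n / (1 + mass s) * mass s <= 2 * geo R n.
    rewrite mulrAC ler_pdivrMr// ler_wpM2l ?mulr_ge0 ?(ltW (geo_gt0 _ _))//; lra.
  lra.
Unshelve. all: by end_near. Qed.

End GeneratorExists.

(** * Density of the targets *)

Section Windows.
Variable R : realType.
Notation mu := (@lebesgue_measure R).
Implicit Types (f g G : R -> R) (x t w th eta : R) (s : seq (R * R)).

Lemma osc_shift r G th a t : continuous G -> supported r G ->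
  osc th (fun x => G (x - a)) t = osc (th + t * a) G t.
Proof.
move=> cG sG; rewrite /osc.
have h := osc_L1R (th + t * a) t cG sG.
rewrite -(Rint_shift a h); apply: eq_Rintegral => x _ /=.
by rewrite /shift_by; congr (_ * cos _); ring.
Qed.

Lemma oscD r G G' th t : continuous G -> supported r G -> continuous G' -> supported r G' ->
  osc th (fun x => G x + G' x) t = osc th G t + osc th G' t.
Proof.
move=> cG sG cG' sG'; rewrite /osc -RintD;
  [|exact: (osc_L1R _ _ cG sG)|exact: (osc_L1R _ _ cG' sG')].
by apply: eq_Rintegral => x _; rewrite mulrDl.
Qed.

Lemma oscZ r G (c : R) th t : continuous G -> supported r G ->
  osc th (fun x => c * G x) t = c * osc th G t.
Proof.
move=> cG sG; rewrite /osc -RintZ; last exact: (osc_L1R _ _ cG sG).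
by apply: eq_Rintegral => x _; rewrite mulrA.
Qed.

Definition window eta x := pos3 (eta ^+ 2 - x ^+ 2).

Lemma smooth2_window eta : smooth2 (window eta).
Proof.
by apply: smooth2_pos3; apply: smooth2B; [exact: smooth2_cst|exact: smooth2_sqr].
Qed.

Lemma supported_window eta : 0 <= eta -> supported eta (window eta).
Proof.
move=> e0 x ex; apply: pos3_eq0; rewrite (sqr_norm x) subr_le0.
have := ltW ex; nra.
Qed.

Lemma windowN eta x : window eta (- x) = window eta x.
Proof. by rewrite /window sqrrN. Qed.

Definition winhat eta t := osc 0 (window eta) t.

Lemma smooth2_shift f a : smooth2 f -> smooth2 (fun x => f (x - a)).
Proof.
move=> [f1 [f2 [d1 d2 c]]]; have da x : is_derive x 1 (fun y : R => y - a) 1.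
  by apply: (is_derive_eq (derB (is_derive_id x 1) (der_cst a x))); rewrite subr0.
exists (fun x => f1 (x - a)), (fun x => f2 (x - a)); split => [x|x|x].
- by apply: (is_derive_eq (der_comp (da x) (d1 _))); rewrite mulr1.
- by apply: (is_derive_eq (der_comp (da x) (d2 _))); rewrite mulr1.
- exact: (continuous_comp (der_continuous (da x)) (c _)).
Qed.

Lemma supported_shift r f a : supported r f -> supported (r + `|a|) (fun x => f (x - a)).
Proof.
move=> sf x hx; apply: sf; rewrite -(ltrD2r `|a|) (lt_le_trans hx)//.
by rewrite -{1}(subrK a x) ler_normD.
Qed.

Lemma smooth2Z f (c : R) : smooth2 f -> smooth2 (fun x => c * f x).
Proof. by apply: smooth2M; exact: smooth2_cst. Qed.

(** Moving the window to [w] and [- w] modulates its transform by a cosine, and with opposite signs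
    by a sine. The form [x - - w] makes both terms instances of [f (x - a)]. *)
Definition cos_symbol eta w x := 2^-1 * (window eta (x - w) + window eta (x - - w)).
Definition sin_symbol eta w x := 2^-1 * (window eta (x - w) - window eta (x - - w)).

Let ws eta w : smooth2 (fun x => window eta (x - w)).
Proof. by apply: smooth2_shift; exact: smooth2_window. Qed.

Let wsupp eta w : 0 <= eta -> supported (eta + `|w|) (fun x => window eta (x - w)).
Proof. by move=> e0; apply: supported_shift; exact: supported_window. Qed.

Let wsuppN eta w : 0 <= eta -> supported (eta + `|w|) (fun x => window eta (x - - w)).
Proof. by move=> e0; rewrite -(normrN w); exact: wsupp. Qed.

Lemma admissible_cos eta w (N : R) : 0 <= eta -> eta + `|w| <= N ->
  admissible (cos_symbol eta w) (fun=> 0) N.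
Proof.
move=> e0 wN; split.
- by apply: smooth2Z; apply: smooth2D; exact: ws.
- exact: smooth2_cst.
- move=> x; rewrite /cos_symbol.
  have -> : window eta (- x - w) = window eta (x - - w) by rewrite -windowN; congr window; ring.
  have -> : window eta (- x - - w) = window eta (x - w) by rewrite -windowN; congr window; ring.
  ring.
- by move=> x; rewrite oppr0.
- apply: (supported_le wN) => x hx.
  by rewrite /cos_symbol (wsupp e0 hx) (wsuppN e0 hx) addr0 mulr0.
- by [].
Qed.

Lemma admissible_sin eta w (N : R) : 0 <= eta -> eta + `|w| <= N ->
  admissible (fun=> 0) (sin_symbol eta w) N.
Proof.
move=> e0 wN; split => //.
- exact: smooth2_cst.
- by apply: smooth2Z; apply: smooth2B; exact: ws.
- move=> x; rewrite /sin_symbol.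
  have -> : window eta (- x - w) = window eta (x - - w) by rewrite -windowN; congr window; ring.
  have -> : window eta (- x - - w) = window eta (x - w) by rewrite -windowN; congr window; ring.
  ring.
- apply: (supported_le wN) => x hx.
  by rewrite /sin_symbol (wsupp e0 hx) (wsuppN e0 hx) subrr mulr0.
Qed.

Lemma osc_cst0 th t : osc th (fun=> 0) t = 0 :> R.
Proof. by rewrite /osc; under eq_Rintegral do rewrite mul0r; exact: Rint0. Qed.

Lemma target_cos eta w t : 0 <= eta ->
  target (cos_symbol eta w) (fun=> 0) t = winhat eta t * cos (w * t).
Proof.
move=> e0; rewrite /target osc_cst0 addr0 /cos_symbol.
have cw a : continuous (fun x => window eta (x - a)) by exact: smooth2_continuous.
have c0 := smooth2_continuous (@smooth2_window eta).
have s0 := supported_window e0.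
rewrite (@oscZ (eta + `|w|)); first last.
- by move=> x hx; rewrite (wsupp e0 hx) (wsuppN e0 hx) addr0.
- by move=> x; apply: cvgD; exact: cw.
rewrite (@oscD (eta + `|w|)); [|exact: cw|exact: wsupp|exact: cw|exact: wsuppN].
rewrite !(osc_shift _ _ _ c0 s0) /winhat /osc -RintD;
  [|exact: (osc_L1R _ _ c0 s0)|exact: (osc_L1R _ _ c0 s0)].
rewrite -RintZ; last first.
  by apply: L1RD; exact: (osc_L1R _ _ c0 s0).
rewrite [RHS]mulrC -RintZ; last exact: (osc_L1R _ _ c0 s0).
apply: eq_Rintegral => x _; rewrite -mulrDr !add0r addr0 mulrN cos_addsub.
by rewrite [w * t]mulrC; field.
Qed.

Lemma target_sin eta w t : 0 <= eta ->
  target (fun=> 0) (sin_symbol eta w) t = winhat eta t * sin (w * t).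
Proof.
move=> e0; rewrite /target osc_cst0 add0r /sin_symbol.
have cw a : continuous (fun x => window eta (x - a)) by exact: smooth2_continuous.
have c0 := smooth2_continuous (@smooth2_window eta).
have s0 := supported_window e0.
rewrite (@oscZ (eta + `|w|)); first last.
- by move=> x hx; rewrite (wsupp e0 hx) (wsuppN e0 hx) subr0.
- by move=> x; apply: cvgB; exact: cw.
rewrite (@oscB _ (eta + `|w|)); [|exact: cw|exact: wsupp|exact: cw|exact: wsuppN].
rewrite !(osc_shift _ _ _ c0 s0) /winhat /osc -RintB;
  [|exact: (osc_L1R _ _ c0 s0)|exact: (osc_L1R _ _ c0 s0)].
rewrite -RintZ; last first.
  by apply: L1RB; exact: (osc_L1R _ _ c0 s0).
rewrite [RHS]mulrC -RintZ; last exact: (osc_L1R _ _ c0 s0).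
apply: eq_Rintegral => x _; rewrite -mulrBr addr0.
have -> : t * x + (- (pi / 2) + t * w) = (t * x + t * w) - pi / 2 by ring.
have -> : t * x + (- (pi / 2) + t * - w) = (t * x - t * w) - pi / 2 by ring.
rewrite !cosBpihalf sinD sinB [w * t]mulrC; by field.
Qed.

Lemma L1R_restrict f (D : set R) : measurable D -> mu.-integrable D (EFin \o f) -> L1R (f \_ D).
Proof.
by move=> mD hf; rewrite /L1R -restrict_EFin; apply/(integrable_mkcond _ _).1.
Qed.

Lemma window_int_gt0 eta : 0 < eta -> 0 < \int[mu]_x window eta x.
Proof.
move=> e0; pose c := pos3 (eta ^+ 2 - (eta / 2) ^+ 2).
have c0 : 0 < c by apply: pos3_gt0; nra.
pose D : set R := `[- (eta / 2), eta / 2]%classic.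
have iD : mu.-integrable D (EFin \o (fun=> c)).
  apply: continuous_compact_integrable; first exact: segment_compact.
  by apply: continuous_subspaceT => x; exact: cvg_cst.
have iw : L1R (window eta).
  apply: (@L1R_supported _ eta); last exact/supported_window/ltW.
  exact: smooth2_continuous (smooth2_window eta).
apply: (@lt_le_trans _ _ (\int[mu]_x ((fun=> c) \_ D) x)).
  rewrite -Rintegral_mkcond Rintegral_cst; last exact: measurable_itv.
  rewrite /= /D lebesgue_measure_itv/= lte_fin ifT; last by lra.
  rewrite /= mulr_gt0//; lra.
apply: le_Rint => //; first by apply: L1R_restrict => //; exact: measurable_itv.
move=> x; rewrite patchE; case: ifPn => [|_]; last exact: pos3_ge0.
rewrite /D inE/= in_itv/= -ler_norml => xe; rewrite /c /window /pos3.
have m0 y : 0 <= Num.max y (0 : R) by rewrite le_max lexx orbT.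
rewrite lerXn2r ?nnegrE ?m0// ge_max m0 andbT le_max; apply/orP; left.
by have := normr_ge0 x; rewrite lerD2l lerN2 (sqr_norm x); nra.
Qed.

(** On the support of the window [|t * x| <= 1], where the cosine is at least [cos 1 > 0]. A narrow
    window thus has a transform without zeros on a prescribed interval, by which one can divide. *)
Lemma winhat_lower eta t : 0 <= eta -> eta * `|t| <= 1 ->
  cos 1 * \int[mu]_x window eta x <= winhat eta t.
Proof.
move=> e0 et; have cw := smooth2_continuous (smooth2_window eta).
have sw := supported_window e0; have iw := L1R_supported cw sw.
rewrite -RintZ// /winhat /osc; apply: le_Rint.
- exact: L1RZ.
- exact: (osc_L1R _ _ cw sw).
move=> x; rewrite mulrC addr0; have [xe|ex] := leP `|x| eta; last by rewrite sw// !mul0r.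
rewrite ler_wpM2l ?pos3_ge0// -[leRHS]cos_norm normrM.
have h : `|t| * `|x| <= 1 by have := normr_ge0 t; have := normr_ge0 x; nra.
have p2 := @pi_ge2 R.
have h0 : 0 <= `|t| * `|x| by rewrite mulr_ge0.
have i1 : `|t| * `|x| \in `[0, pi] by rewrite in_itv/= h0/=; lra.
have i2 : (1 : R) \in `[0, pi] by rewrite in_itv/= ler01/=; lra.
by rewrite leNgt ltr_cos// -leNgt.
Qed.

End Windows.

(** * Approximation in L^1 by modulated windows *)

Section Density.
Variable R : realType.
Notation mu := (@lebesgue_measure R).
Implicit Types (f g h : R -> R) (x t : R) (s : seq (R * R)).

Lemma comb_cat (phi : R -> R) s1 s2 t : comb phi (s1 ++ s2) t = comb phi s1 t + comb phi s2 t.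
Proof. by rewrite /comb big_cat. Qed.

Lemma L1R_comb phi s : L1R phi -> L1R (comb phi s).
Proof.
move=> hp; apply: L1R_sum => p; apply: L1RZ; exact: L1R_shift.
Qed.

Lemma L1R_wt_bound f (K : R) : continuous f -> (forall t, `|f t| <= K * wt t) -> L1R f.
Proof.
move=> cf fK; apply: (le_L1R _ fK); first exact: continuous_measurable_fun.
by apply: L1RZ; exact: L1R_wt.
Qed.

Lemma winhat_continuous (eta : R) : 0 <= eta -> continuous (winhat eta).
Proof.
move=> e0; have [K K0 HK] := osc_lipschitz e0 (smooth2_window eta) (supported_window e0).
move=> t; apply/cvgrPdist_lt => e e1; near=> t'.
apply: (le_lt_trans (HK 0 t t')).
apply: (@le_lt_trans _ _ ((K + 1) * `|t - t'|)); first by rewrite ler_wpM2r// lerDl.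
rewrite -ltr_pdivlMl ?ltr_wpDl//.
near: t'; move: (t) => z; have /cvgrPdist_lt := @cvg_id _ (nbhs z).
by apply; rewrite mulr_gt0// invr_gt0 ltr_wpDl.
Unshelve. all: by end_near. Qed.

Lemma smooth2_cosM (w : R) : smooth2 (fun t => cos (w * t)).
Proof. by have := smooth2_cosa w 0; under eq_fun do rewrite addr0. Qed.

Lemma smooth2_sinM (w : R) : smooth2 (fun t => sin (w * t)).
Proof. by have := smooth2_cosa w (- (pi / 2)); under eq_fun do rewrite cosBpihalf. Qed.

Lemma compact_support_approx g (d : R) : L1R g -> 0 < d ->
  exists G (A : R), [/\ 0 <= A, continuous G, supported A G &
    \int[mu]_x `|g x - G x| <= d].
Proof.
move=> hg d0; have d20 : 0 < d / 2 by rewrite divr_gt0.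
have [A0 A00 HA] := L1R_tail hg d20.
pose A := A0 + 1; pose D : set (measurableTypeR R) := `[- A, A]%classic.
have mD : measurable D by exact: measurable_itv.
have igD : mu.-integrable D (EFin \o g) by apply: integrableS hg.
have muD : (mu D < +oo)%E.
  by apply: compact_finite_measure; exact: segment_compact.
have [g_ [cg_ ig_ cvg_]] := approximation_continuous_integrable mD muD igD.
have [n Hn] : exists n, (\int[mu]_(z in D) `|(g z - g_ n z)%:E| < (d / 2)%:E)%E.
  have /fine_cvgP[h1 /cvgrPdist_lt/(_ _ d20) h2] := cvg_.
  near \oo => n; exists n.
  have fn : (\int[mu]_(z in D) `|(g z - g_ n z)%:E|)%E \is a fin_num by near: n.
  rewrite -(fineK fn) lte_fin (le_lt_trans (ler_norm _))//.
  by rewrite -normrN -sub0r; near: n.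
(* A cutoff equal to 1 up to [A0] and to 0 from [A = A0 + 1] on. In between the error is a convex
   combination of [g] and [g - g_ n], both already small in L^1 there. *)
pose chi x : R := Num.max 0 (Num.min 1 (A - `|x|)).
have chi01 x : 0 <= chi x <= 1 by rewrite /chi le_max lexx/= ge_max ler01 ge_min lexx.
have cchi : continuous chi.
  move=> x; apply: (@continuous_max _ _ (cst 0) (fun z : R => Num.min 1 (A - `|z|))).
    exact: cst_continuous.
  apply: (@continuous_min _ _ (cst 1) (fun z : R => A - `|z|)); first exact: cst_continuous.
  apply: cvgB; first exact: cvg_cst.
  by apply: cvg_norm; exact: cvg_id.
pose G x := g_ n x * chi x.
have cG : continuous G by apply: continuousM => //; exact: cg_.
have sG : supported A G.
  move=> x Ax; rewrite /G /chi max_l ?mulr0// ge_min; apply/orP; right; lra.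
exists G, A; split => //; first by rewrite /A; lra.
have iG := L1R_supported cG sG.
pose e x : R := `|g x - g_ n x|.
have ie : mu.-integrable D (EFin \o e).
  have : mu.-integrable D (EFin \o (fun x => g x - g_ n x)).
    exact: (integrableB mD igD (ig_ n)).
  by move/integrable_norm.
have ie' : L1R (e \_ D) by exact: L1R_restrict.
have inte : \int[mu]_x (e \_ D) x <= d / 2.
  rewrite -Rintegral_mkcond /Rintegral -lee_fin fineK; last exact: integrable_fin_num.
  exact: ltW.
pose tl x := if `|x| <= A0 then 0 else `|g x|.
have itl : L1R tl := L1R_outside A0 hg.
apply: (@le_trans _ _ (\int[mu]_x (tl x + (e \_ D) x))); last first.
  rewrite RintD//; apply: (le_trans (lerD (HA _ (lexx _)) inte)).
  by rewrite -splitr.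
apply: le_Rint; [exact: L1R_norm (L1RB hg iG)|exact: L1RD|] => x.
have e0 : 0 <= (e \_ D) x by rewrite patchE; case: ifP => _ //; exact: normr_ge0.
have [xA|Ax] := leP `|x| A; last first.
  by rewrite sG// subr0 /tl ifF ?lerDl//; apply/negbTE; rewrite -ltNge /A in Ax *; lra.
have -> : (e \_ D) x = e x.
  by rewrite patchE ifT// /D inE/= in_itv/= -ler_norml.
rewrite /tl; case: ifPn => [xA0|].
  have -> : G x = g_ n x; last by rewrite add0r.
  by rewrite /G /chi min_l ?max_r ?mulr1// /A; lra.
move=> _; have := chi01 x => /andP[c0 c1].
have -> : g x - G x = (1 - chi x) * g x + chi x * (g x - g_ n x) by rewrite /G; ring.
apply: (le_trans (ler_normD _ _)); rewrite !normrM (ger0_norm c0) ger0_norm ?subr_ge0//.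
have := normr_ge0 (g x); have := normr_ge0 (g x - g_ n x); rewrite /e => h1 h2.
nra.
Unshelve. all: by end_near. Qed.

Variables (phi : R -> R) (L : set R).
Hypothesis hphi : L1R phi.

Definition approximable h := forall d : R, 0 < d ->
  exists s, (forall p, p \in s -> L p.2) /\ \int[mu]_x `|h x - comb phi s x| <= d.

Lemma approximable0 : approximable (fun=> 0).
Proof.
move=> d d0; exists [::]; split => //.
under eq_Rintegral do rewrite /comb big_nil subrr normr0.
by rewrite Rint0 ltW.
Qed.

Lemma approximableD f g : L1R f -> L1R g -> approximable f -> approximable g ->
  approximable (fun x => f x + g x).
Proof.
move=> hf hg af ag d d0; have d20 : 0 < d / 2 by rewrite divr_gt0.
have [s1 [L1 H1]] := af _ d20; have [s2 [L2 H2]] := ag _ d20.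
exists (s1 ++ s2); split; first by move=> p; rewrite mem_cat => /orP[/L1|/L2].
have i1 := L1R_norm (L1RB hf (L1R_comb s1 hphi)).
have i2 := L1R_norm (L1RB hg (L1R_comb s2 hphi)).
apply: (@le_trans _ _ (\int[mu]_x (`|f x - comb phi s1 x| + `|g x - comb phi s2 x|))).
  apply: le_Rint.
  - exact: L1R_norm (L1RB (L1RD hf hg) (L1R_comb (s1 ++ s2) hphi)).
  - exact: L1RD.
  - by move=> x; rewrite comb_cat opprD addrACA ler_normD.
by rewrite RintD//; lra.
Qed.

Lemma approximableZ f (c : R) : L1R f -> approximable f -> approximable (fun x => c * f x).
Proof.
move=> hf af d d0; have d20 : 0 < d / (`|c| + 1) by rewrite divr_gt0// ltr_wpDl.
have [s [Ls Hs]] := af _ d20.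
exists [seq (c * p.1, p.2) | p <- s]; split; first by move=> p /mapP[q /Ls ? ->].
have e x : c * f x - comb phi [seq (c * p.1, p.2) | p <- s] x = c * (f x - comb phi s x).
  rewrite /comb big_map mulrBr mulr_sumr; congr (_ - _).
  by apply: eq_bigr => p _; rewrite mulrA.
under eq_Rintegral do rewrite e normrM.
rewrite RintZ; last exact: L1R_norm (L1RB hf (L1R_comb s hphi)).
apply: (@le_trans _ _ ((`|c| + 1) * (d / (`|c| + 1)))); last first.
  by rewrite mulrCA divff ?mulr1// gt_eqF// ltr_wpDl.
by apply: ler_pM => //; [exact: Rint_ge0|rewrite lerDl].
Qed.

Lemma approximable_lim g : L1R g -> (forall d : R, 0 < d -> exists h,
  [/\ L1R h, approximable h & \int[mu]_x `|g x - h x| <= d]) -> approximable g.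
Proof.
move=> hg H d d0; have d20 : 0 < d / 2 by rewrite divr_gt0.
have [h [hh ah gh]] := H _ d20; have [s [Ls Hs]] := ah _ d20.
exists s; split => //; have ic := L1R_comb s hphi.
apply: (@le_trans _ _ (\int[mu]_x (`|g x - h x| + `|h x - comb phi s x|))).
  apply: le_Rint.
  - exact: L1R_norm (L1RB hg ic).
  - by apply: L1RD; apply: L1R_norm; exact: L1RB.
  - by move=> x; rewrite (le_trans _ (ler_normD _ _))// addrA subrK.
by rewrite RintD; [lra|exact: L1R_norm (L1RB _ _)..].
Qed.

Hypothesis Hcos : forall (n : nat) (q : rat),
  approximable (fun t => winhat n.+1%:R^-1 t * cos (ratr q * t)).
Hypothesis Hsin : forall (n : nat) (q : rat),
  approximable (fun t => winhat n.+1%:R^-1 t * sin (ratr q * t)).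

Lemma winhat_decay (eta : R) : 0 <= eta ->
  exists2 C : R, 0 <= C & forall t, `|winhat eta t| <= C * wt t.
Proof.
move=> e0; have [C C0 HC] := osc_decay_smooth2 (smooth2_window eta) (supported_window e0) e0.
by exists C => // t; exact: HC.
Qed.

Lemma L1R_winhatM (eta K : R) f : 0 <= eta -> continuous f -> (forall x, `|f x| <= K) ->
  L1R (fun t => winhat eta t * f t).
Proof.
move=> e0 cf fK; have [C C0 HC] := winhat_decay e0.
apply: (@L1R_wt_bound _ (C * K)).
  by apply: continuousM => //; exact: winhat_continuous.
move=> t; rewrite normrM mulrAC; apply: ler_pM => //.
Qed.

Lemma approximable_trig (n : nat) (Q : R -> R) :
  trig_poly [set ratr q | q in [set: rat]] Q ->
  approximable (fun t => winhat n.+1%:R^-1 t * Q t).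
Proof.
move=> [s [sD sQ]]; set eta := n.+1%:R^-1.
have e0 : 0 <= eta by rewrite invr_ge0.
have -> : (fun t => winhat eta t * Q t) =
  (fun t => \sum_(p <- s) (complex.Re p.1 * (winhat eta t * cos (p.2 * t)) +
                          - complex.Im p.1 * (winhat eta t * sin (p.2 * t)))).
  apply/funext => t; have -> : Q t = complex.Re (exp_poly s t) by rewrite sQ.
  rewrite Re_exp_poly mulr_sumr; apply: eq_bigr => p _; ring.
have ic (w : R) : L1R (fun t => winhat eta t * cos (w * t)).
  apply: (@L1R_winhatM _ 1) => //; last by move=> x; exact: cos_norm_le1.
  exact: smooth2_continuous (smooth2_cosM w).
have is_ (w : R) : L1R (fun t => winhat eta t * sin (w * t)).
  apply: (@L1R_winhatM _ 1) => //; last by move=> x; exact: sin_norm_le1.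
  exact: smooth2_continuous (smooth2_sinM w).
elim: s sD {sQ} => [|p s IH] sD.
  by under eq_fun do rewrite big_nil; exact: approximable0.
under eq_fun do rewrite big_cons.
have i1 : L1R (fun t => complex.Re p.1 * (winhat eta t * cos (p.2 * t)) +
                          - complex.Im p.1 * (winhat eta t * sin (p.2 * t))).
  by apply: L1RD; apply: L1RZ.
apply: approximableD => //.
- by apply: L1R_sum => q; apply: L1RD; apply: L1RZ.
- have [q _ <-] := sD p (mem_head _ _).
  apply: approximableD; [exact: L1RZ|exact: L1RZ| |].
    exact: approximableZ (Hcos n q).
  exact: approximableZ (Hsin n q).
- by apply: IH => q qs; apply: sD; rewrite inE qs orbT.
Qed.

Theorem windows_dense g : L1R g -> approximable g.
Proof.
move=> hg; apply: approximable_lim => // d d0; have d20 : 0 < d / 2 by rewrite divr_gt0.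
have [G [A [A0 cG sG gG]]] := compact_support_approx hg d20.
pose n := Num.truncn A; pose eta : R := n.+1%:R^-1.
have e0 : 0 < eta by rewrite invr_gt0.
have An : A < n.+1%:R by exact: truncnS_gt.
have eA : eta * A <= 1 by rewrite mulrC ler_pdivrMr// mul1r ltW.
pose c0 := cos 1 * \int[mu]_x window eta x.
have c00 : 0 < c0 by rewrite mulr_gt0 ?cos1_gt0 ?window_int_gt0.
(* The maximum keeps the denominator positive on the whole line; on the support of [G] it is just
   [winhat eta t]. *)
pose q t := G t * (Num.max (winhat eta t) c0)^-1.
have m0 t : 0 < Num.max (winhat eta t) c0 by rewrite lt_max c00 orbT.
have cw := winhat_continuous (ltW e0).
have cq : continuous q.
  apply: continuousM => // t; apply: cvgV; first by rewrite gt_eqF.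
  apply: (@continuous_max _ _ (winhat eta) (cst c0)); first exact: cw.
  exact: cst_continuous.
have sq : supported A q by exact: supportedM.
have qG t : winhat eta t * q t = G t.
  have [tA|At] := leP `|t| A; last by rewrite sq// sG// mulr0.
  rewrite /q max_l; last by apply: winhat_lower; rewrite ?(ltW e0)//; apply: le_trans eA; rewrite ler_wpM2l// ltW.
  rewrite mulrCA divff ?mulr1// gt_eqF// (lt_le_trans c00)//.
  by apply: winhat_lower; rewrite ?(ltW e0)//; apply: le_trans eA; rewrite ler_wpM2l// ltW.
have [K K0 qK] := continuous_supported_bounded A0 cq sq.
have [C C0 HC] := winhat_decay (ltW e0).
pose I := \int[mu]_x (wt x : R).
have I0 : 0 <= I by apply: Rint_ge0 => x; exact/ltW/wt_gt0.
(* [d1] bounds [q - Q] up to [L0]; [d2] bounds the tail of [wt] beyond, where only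
   [|q - Q| <= 2 * K] is known. *)
pose d1 := d / 4 / (C * I + 1).
have d10 : 0 < d1 by rewrite !divr_gt0// ltr_wpDl// mulr_ge0.
pose d2 := d / 4 / (C * (2 * K) + 1).
have d200 : 0 < d2 by rewrite !divr_gt0// ltr_wpDl// !mulr_ge0.
have [L0 L00 HL] := L1R_tail (@L1R_wt R) d200.
(* The global bound on [Q] is essential here: [L0] was chosen from [K] before [Q] is known. *)
have [Q [tQ Q1 Q2]] := trig_poly_approx L0 cq d10 qK.
have cQ : continuous Q.
  have [s [_ sQ]] := tQ.
  have -> : Q = fun t => \sum_(p <- s) (complex.Re p.1 * cos (p.2 * t) + - complex.Im p.1 * sin (p.2 * t)).
    apply/funext => t; have -> : Q t = complex.Re (exp_poly s t) by rewrite sQ.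
    by rewrite Re_exp_poly; apply: eq_bigr => p _; rewrite mulNr.
  apply: smooth2_continuous; apply: smooth2_sum => p.
  apply: smooth2D; apply: smooth2Z.
    exact: smooth2_cosM.
  exact: smooth2_sinM.
have iQ : L1R (fun t => winhat eta t * Q t) by exact: (L1R_winhatM (ltW e0) cQ Q2).
exists (fun t => winhat eta t * Q t); split => //; first exact: approximable_trig.
have iG := L1R_supported cG sG.
pose tl x : R := if `|x| <= L0 then 0 else `|wt x|.
have itl : L1R tl := L1R_outside L0 (@L1R_wt R).
have GQ : \int[mu]_x `|G x - winhat eta x * Q x| <= d / 2.
  apply: (@le_trans _ _ (\int[mu]_x (C * d1 * wt x + C * (2 * K) * tl x))).
    apply: le_Rint.
    - exact: L1R_norm (L1RB iG iQ).
    - by apply: L1RD; apply: L1RZ => //; exact: L1R_wt.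
    move=> t; rewrite -qG -mulrBr normrM.
    have w0 := wt_gt0 t.
    rewrite /tl; have [tL|Lt] := leP `|t| L0.
      rewrite mulr0 addr0 mulrAC; apply: ler_pM => //; exact: Q1.
    rewrite (gtr0_norm w0).
    apply: (@le_trans _ _ (C * wt t * (2 * K))).
      apply: ler_pM => //; apply: (le_trans (ler_normB _ _)).
      by have := qK t; have := Q2 t; lra.
    by rewrite mulrAC lerDr; apply: mulr_ge0; [apply: mulr_ge0 => //|]; exact: ltW.
  have iw := @L1R_wt R.
  rewrite (RintD (L1RZ (C * d1) iw) (L1RZ (C * (2 * K)) itl)) (RintZ _ iw) (RintZ _ itl).
  have h2 := HL _ (lexx _); rewrite -/tl in h2.
  have h3 : C * d1 * I <= d / 4.
    have : (C * I + 1) * d1 = d / 4.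
      by rewrite /d1; field; rewrite gt_eqF// ltr_wpDl// mulr_ge0.
    lra.
  have h4 : C * (2 * K) * \int[mu]_x tl x <= d / 4.
    have : (C * (2 * K) + 1) * d2 = d / 4.
      by rewrite /d2; field; rewrite gt_eqF// ltr_wpDl// !mulr_ge0.
    have : C * (2 * K) * \int[mu]_x tl x <= C * (2 * K) * d2 by rewrite ler_wpM2l// !mulr_ge0.
    lra.
  rewrite -/I; lra.
apply: (@le_trans _ _ (\int[mu]_x (`|g x - G x| + `|G x - winhat eta x * Q x|))).
  apply: le_Rint.
  - exact: L1R_norm (L1RB hg iQ).
  - by apply: L1RD; apply: L1R_norm; exact: L1RB.
  - by move=> x; rewrite (le_trans _ (ler_normD _ _))// addrA subrK.
by rewrite RintD; [lra|exact: L1R_norm (L1RB _ _)..].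
Qed.

End Density.

(** * From completeness to generators *)

Section RadiusToGenerator.
Variable R : realType.
Notation mu := (@lebesgue_measure R).
Implicit Types (f g h : R -> R) (x t rho : R).

(** Composing with this retraction extends a function from the segment to the line and keeps it
    continuous and bounded. *)
Definition clamp (rho x : R) : R := Num.max (- rho) (Num.min x rho).

Lemma clamp_continuous rho : continuous (clamp rho).
Proof.
move=> y; apply: (@continuous_max _ _ (cst (- rho)) (fun z : R => Num.min z rho)).
  exact: cst_continuous.
by apply: (@continuous_min _ _ idfun (cst rho)) => //; exact: cst_continuous.
Qed.

Lemma clamp_itv rho x : 0 <= rho -> clamp rho x \in `[- rho, rho].
Proof.
move=> r0; rewrite in_itv/= /clamp le_max lexx/= ge_max ge_min lexx orbT andbT; lra.
Qed.

Lemma clamp_id rho x : x \in `[- rho, rho] -> clamp rho x = x.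
Proof. by rewrite in_itv/= => /andP[h1 h2]; rewrite /clamp min_l// max_r. Qed.

Lemma within_clamp_continuous rho f : 0 <= rho -> {within `[- rho, rho], continuous f} ->
  continuous (f \o clamp rho).
Proof.
move=> r0 /subspace_continuousP cf x.
have h := cf (clamp rho x) (clamp_itv x r0).
apply: cvg_comp h => P; rewrite /= nbhs_simpl /within /= => HP.
have [e e0 He] := @clamp_continuous rho x _ HP; exists e => // y /He; apply.
exact: (clamp_itv y r0).
Qed.

Lemma exp_complete_le (L : set R) (rho rho' : R) : rho <= rho' ->
  exp_complete L rho' -> exp_complete L rho.
Proof.
move=> rr H f cRe cIm eps e0.
have [r0|r0] := leP 0 rho; last first.
  by exists [::]; split => // x; rewrite in_itv/= => /andP[? ?]; lra.
have [||s [sL Hs]] := H (f \o clamp rho) _ _ eps e0.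
- exact: continuous_subspaceT (within_clamp_continuous r0 cRe).
- exact: continuous_subspaceT (within_clamp_continuous r0 cIm).
exists s; split => // x xr; have := Hs x; rewrite /= clamp_id//; apply.
by move: xr; rewrite !in_itv/= => /andP[? ?]; apply/andP; split; lra.
Qed.

(** Completeness passes to smaller segments, so a failure at [rho] would bound the radius. *)
Lemma radius_pinfty_complete (L : set R) : spectral_radius L = +oo%E ->
  forall rho : R, exp_complete L rho.
Proof.
move=> HL rho; apply: contrapT => nc.
suff : (spectral_radius L <= (Num.max 0 rho)%:E)%E by rewrite HL.
apply: ge_ereal_sup => _ [->|[r [r0 rc] <-]]; first by rewrite lee_fin le_max lexx.
rewrite lee_fin le_max leNgt [0 < r]r0/= leNgt; apply/negP => rr.
by apply: nc; apply: exp_complete_le rc; exact: ltW.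
Qed.

Lemma real_generator (L : set R) : (forall rho : R, exp_complete L rho) ->
  exists phi : R -> R, [/\ continuous phi, L1R phi & forall g, L1R g -> approximable phi L g].
Proof.
move=> HL.
(* Enumerates window widths, rational frequencies and the choice between cosine and sine. Numbers
   that code nothing get a default triple, so every index gives an admissible target. *)
pose idx (j : nat) : nat * rat * bool := odflt (0%N, 0, true) (unpickle j).
pose eta j : R := (idx j).1.1.+1%:R^-1.
pose w j : R := ratr (idx j).1.2.
have e0 j : 0 <= eta j by rewrite invr_ge0.
pose P1 j := if (idx j).2 then cos_symbol (eta j) (w j) else (fun=> 0).
pose P2 j := if (idx j).2 then (fun=> 0) else sin_symbol (eta j) (w j).
pose N j := (Num.truncn (eta j + `|w j|)).+1.
have adm j : admissible (P1 j) (P2 j) (N j)%:R.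
  have le : eta j + `|w j| <= (N j)%:R by apply: ltW; exact: truncnS_gt.
  by rewrite /P1 /P2; case: ifP => _; [exact: admissible_cos|exact: admissible_sin].
have [phi [cphi [K HK] Hphi]] := generator_exists HL adm.
have iphi : L1R phi by exact: L1R_wt_bound HK.
(* Closeness relative to [wt] integrates to closeness in L^1; continuity of the target makes the
   difference measurable. *)
have At j : continuous (target (P1 j) (P2 j)) -> approximable phi L (target (P1 j) (P2 j)).
  move=> ct d d0; pose I := \int[mu]_x (wt x : R).
  have I0 : 0 <= I by apply: Rint_ge0 => x; exact/ltW/wt_gt0.
  have d1 : 0 < d / (I + 1) by rewrite divr_gt0// ltr_wpDl.
  have [s [sL Hs]] := Hphi j _ d1; exists s; split => //.
  have iw := @L1R_wt R; have ic := L1R_comb s iphi.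
  apply: (@le_trans _ _ (\int[mu]_x (d / (I + 1) * wt x))).
    apply: le_Rint; last by move=> x; rewrite distrC.
      have mc := L1R_measurable ic; have mt := continuous_measurable_fun ct.
      have : L1R (fun x => comb phi s x - target (P1 j) (P2 j) x).
        by apply: (le_L1R _ Hs); [exact: measurable_funB|exact: L1RZ].
      by move/L1R_norm; under eq_fun do rewrite distrC.
    exact: L1RZ.
  rewrite RintZ// -/I mulrAC ler_pdivrMr ?ltr_wpDl// ler_wpM2l ?(ltW d0)//; lra.
have wq n : 0 <= n.+1%:R^-1 :> R by rewrite invr_ge0.
exists phi; split => // g hg; apply: windows_dense => // n q.
- have := At (pickle (n, q, true)); rewrite /P1 /P2 /eta /w /idx pickleK/=.
  have -> : target (cos_symbol n.+1%:R^-1 (ratr q)) (fun=> 0) =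
      (fun t : R => winhat n.+1%:R^-1 t * cos (ratr q * t)).
    by apply/funext => t; rewrite target_cos.
  apply; apply: continuousM; first exact: winhat_continuous.
  exact: smooth2_continuous (smooth2_cosM _).
- have := At (pickle (n, q, false)); rewrite /P1 /P2 /eta /w /idx pickleK/=.
  have -> : target (fun=> 0) (sin_symbol n.+1%:R^-1 (ratr q)) =
      (fun t : R => winhat n.+1%:R^-1 t * sin (ratr q * t)).
    by apply/funext => t; rewrite target_sin.
  apply; apply: continuousM; first exact: winhat_continuous.
  exact: smooth2_continuous (smooth2_sinM _).
Qed.

Lemma measurable_cabs (F : R -> R[i]) :
  measurable_fun setT (fun x => complex.Re (F x)) ->
  measurable_fun setT (fun x => complex.Im (F x)) ->
  measurable_fun setT (fun x => cabs (F x)).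
Proof.
move=> mR mI.
have -> : (fun x => cabs (F x)) =
    (@Num.sqrt R) \o (fun x => complex.Re (F x) ^+ 2 + complex.Im (F x) ^+ 2).
  by apply/funext => x; rewrite /cabs /=; case: (F x).
apply: measurableT_comp; first exact: continuous_measurable_fun (@sqrt_continuous R).
by apply: measurable_funD; apply: measurable_funX.
Qed.

Lemma L1R_cabs (F : R -> R[i]) : L1 F -> L1R (fun x => cabs (F x)).
Proof.
move=> [iR iI]; apply: (@le_L1R _ _ (fun x => `|complex.Re (F x)| + `|complex.Im (F x)|)).
- by apply: measurable_cabs; exact: L1R_measurable.
- by move=> x; rewrite ger0_norm ?cabs_ge0// cabs_le.
- by apply: L1RD; exact: L1R_norm.
Qed.

Lemma L1B (F G : R -> R[i]) : L1 F -> L1 G -> L1 (fun x => F x - G x).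
Proof.
move=> [FR FI] [GR GI]; split.
  by under eq_fun do rewrite ReD ReN; exact: (L1RB FR GR).
by under eq_fun do rewrite ImD ImN; exact: (L1RB FI GI).
Qed.

Lemma L1distE (F G : R -> R[i]) : L1 F -> L1 G ->
  L1dist F G = (\int[mu]_x cabs (F x - G x))%:E.
Proof. by move=> hF hG; rewrite /L1dist integral_EFin//; exact: L1R_cabs (L1B hF hG). Qed.

(** A real generator is also a complex one: the real and imaginary parts of [g] are approximated
    separately, the latter with imaginary coefficients. *)
Lemma complete_generator (L : set R) : (forall rho : R, exp_complete L rho) ->
  exists phi : R -> R[i], L1 phi /\ translates_dense L phi.
Proof.
move=> HL; have [phi [cphi iphi Hphi]] := real_generator HL.
exists (fun t => Complex (phi t) 0); split; first by split => //; exact: L1R0.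
move=> g [gR gI] eps e0; have e40 : 0 < eps / 4 by rewrite divr_gt0.
have [s1 [L1 H1]] := Hphi _ gR _ e40; have [s2 [L2 H2]] := Hphi _ gI _ e40.
exists ([seq (Complex p.1 0, p.2) | p <- s1] ++ [seq (Complex 0 p.1, p.2) | p <- s2]).
set s := _ ++ _; split.
  by move=> p; rewrite mem_cat => /orP[] /mapP[q qs ->] /=; [exact: L1|exact: L2].
have tR t : complex.Re (transl_comb (fun t => Complex (phi t) 0) s t) = comb phi s1 t.
  rewrite /transl_comb big_cat/= !big_map ReD !Re_sum [X in _ + X]big1 ?addr0.
    by apply: eq_bigr => p _; rewrite ReM/= mul0r subr0.
  by move=> p _; rewrite ReM/= mul0r mulr0 subr0.
have tI t : complex.Im (transl_comb (fun t => Complex (phi t) 0) s t) = comb phi s2 t.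
  rewrite /transl_comb big_cat/= !big_map ImD !Im_sum big1 ?add0r.
    by apply: eq_bigr => p _; rewrite ImM/= mul0r add0r.
  by move=> p _; rewrite ImM/= mul0r mulr0 addr0.
have i1 := L1R_comb s1 iphi; have i2 := L1R_comb s2 iphi.
have it : Defs.L1 (transl_comb (fun t => Complex (phi t) 0) s).
  by split; [under eq_fun do rewrite tR|under eq_fun do rewrite tI].
have ig : Defs.L1 g by [].
rewrite L1distE// lte_fin.
have j1 := L1R_norm (L1RB gR i1); have j2 := L1R_norm (L1RB gI i2).
apply: (@le_lt_trans _ _ (eps / 4 + eps / 4)); last by lra.
apply: le_trans (lerD H1 H2); rewrite -RintD//.
apply: le_Rint; [exact: L1R_cabs (L1B ig it)|exact: L1RD|] => x.
by apply: (le_trans (cabs_le _)); rewrite ReD ImD ReN ImN tR tI.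
Qed.

End RadiusToGenerator.

(** * From generators to completeness *)

Section GeneratorToRadius.
Variable R : realType.
Notation mu := (@lebesgue_measure R).
Implicit Types (g h phi : R -> R[i]) (x t rho : R) (s : seq (R[i] * R)).

Definition fourier_re g x := \int[mu]_t
  (complex.Re (g t) * cos (x * t) - complex.Im (g t) * sin (x * t)).
Definition fourier_im g x := \int[mu]_t
  (complex.Re (g t) * sin (x * t) + complex.Im (g t) * cos (x * t)).
Definition fourier g x : R[i] := Complex (fourier_re g x) (fourier_im g x).

Lemma measurable_cosM x : measurable_fun setT (fun t : R => cos (x * t)).
Proof. exact: continuous_measurable_fun (smooth2_continuous (smooth2_cosM x)). Qed.

Lemma measurable_sinM x : measurable_fun setT (fun t : R => sin (x * t)).
Proof. exact: continuous_measurable_fun (smooth2_continuous (smooth2_sinM x)). Qed.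

Lemma L1R_cosM (f : R -> R) x : L1R f -> L1R (fun t => f t * cos (x * t)).
Proof.
move=> hf; apply: (L1R_mulbd hf (K := 1)); first exact: measurable_cosM.
by move=> t; exact: cos_norm_le1.
Qed.

Lemma L1R_sinM (f : R -> R) x : L1R f -> L1R (fun t => f t * sin (x * t)).
Proof.
move=> hf; apply: (L1R_mulbd hf (K := 1)); first exact: measurable_sinM.
by move=> t; exact: sin_norm_le1.
Qed.

Lemma L1_add g h : L1 g -> L1 h -> L1 (fun t => g t + h t).
Proof.
move=> [gR gI] [hR hI]; split.
  by under eq_fun do rewrite ReD; exact: (L1RD gR hR).
by under eq_fun do rewrite ImD; exact: (L1RD gI hI).
Qed.

Lemma L1_scale (c : R[i]) g : L1 g -> L1 (fun t => c * g t).
Proof.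
move=> [gR gI]; split.
  by under eq_fun do rewrite ReM; exact: (L1RB (L1RZ _ gR) (L1RZ _ gI)).
by under eq_fun do rewrite ImM; exact: (L1RD (L1RZ _ gI) (L1RZ _ gR)).
Qed.

Lemma L1_translate g (a : R) : L1 g -> L1 (fun t => g (t - a)).
Proof. by move=> [gR gI]; split; [exact: (L1R_shift a gR)|exact: (L1R_shift a gI)]. Qed.

Lemma L1_zero : L1 (fun=> 0 : R[i]).
Proof. by split; exact: L1R0. Qed.

Lemma fourierD g h x : L1 g -> L1 h ->
  fourier (fun t => g t + h t) x = fourier g x + fourier h x.
Proof.
move=> [gR gI] [hR hI]; apply: complex_eq; rewrite ?ReD ?ImD/=.
- rewrite /fourier_re -RintD; [|by apply: L1RB; [exact: L1R_cosM|exact: L1R_sinM]..].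
  by apply: eq_Rintegral => t _; rewrite ReD ImD; ring.
- rewrite /fourier_im -RintD; [|by apply: L1RD; [exact: L1R_sinM|exact: L1R_cosM]..].
  by apply: eq_Rintegral => t _; rewrite ReD ImD; ring.
Qed.

Lemma fourierZ (c : R[i]) g x : L1 g -> fourier (fun t => c * g t) x = c * fourier g x.
Proof.
move=> [gR gI].
have i1 : L1R (fun t => complex.Re (g t) * cos (x * t) - complex.Im (g t) * sin (x * t)).
  by apply: L1RB; [exact: L1R_cosM|exact: L1R_sinM].
have i2 : L1R (fun t => complex.Re (g t) * sin (x * t) + complex.Im (g t) * cos (x * t)).
  by apply: L1RD; [exact: L1R_sinM|exact: L1R_cosM].
apply: complex_eq; rewrite ?ReM ?ImM/= /fourier_re /fourier_im -!(RintZ _ i1) -!(RintZ _ i2).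
- rewrite -RintB; [|exact: L1RZ..].
  by apply: eq_Rintegral => t _; rewrite ReM ImM; ring.
- rewrite -RintD; [|exact: L1RZ..].
  by apply: eq_Rintegral => t _; rewrite ReM ImM; ring.
Qed.

Lemma fourier_translate g (a x : R) : L1 g ->
  fourier (fun t => g (t - a)) x = expi (a * x) * fourier g x.
Proof.
move=> hg; rewrite -fourierZ//.
have [gR gI] := L1_scale (expi (a * x)) hg.
have i1 : L1R (fun t => complex.Re (expi (a * x) * g t) * cos (x * t) -
    complex.Im (expi (a * x) * g t) * sin (x * t)).
  by apply: L1RB; [exact: L1R_cosM|exact: L1R_sinM].
have i2 : L1R (fun t => complex.Re (expi (a * x) * g t) * sin (x * t) +
    complex.Im (expi (a * x) * g t) * cos (x * t)).
  by apply: L1RD; [exact: L1R_sinM|exact: L1R_cosM].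
apply: complex_eq => /=; rewrite /fourier_re /fourier_im.
- rewrite -[RHS](Rint_shift a i1); apply: eq_Rintegral => t _; rewrite /shift_by.
  have -> : x * t = a * x + x * (t - a) by ring.
  by rewrite ReM ImM /= cosD sinD; ring.
- rewrite -[RHS](Rint_shift a i2); apply: eq_Rintegral => t _; rewrite /shift_by.
  have -> : x * t = a * x + x * (t - a) by ring.
  by rewrite ReM ImM /= cosD sinD; ring.
Qed.

Lemma fourier0 x : fourier (fun=> 0) x = 0.
Proof.
by apply: complex_eq => /=; rewrite /fourier_re /fourier_im;
  under eq_Rintegral do rewrite !mul0r ?subr0 ?addr0; exact: Rint0.
Qed.

Lemma L1_transl_comb phi s : L1 phi -> L1 (transl_comb phi s).
Proof.
move=> hp; elim: s => [|p s IH].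
  have -> : transl_comb phi [::] = fun=> 0 by apply/funext => t; rewrite /transl_comb big_nil.
  exact: L1_zero.
have -> : transl_comb phi (p :: s) = fun t => p.1 * phi (t - p.2) + transl_comb phi s t.
  by apply/funext => t; rewrite /transl_comb big_cons.
by apply: L1_add => //; apply: L1_scale; exact: L1_translate.
Qed.

Lemma fourier_transl_comb phi s x : L1 phi ->
  fourier (transl_comb phi s) x = exp_poly s x * fourier phi x.
Proof.
move=> hp; elim: s => [|p s IH].
  have -> : transl_comb phi [::] = fun=> 0 by apply/funext => t; rewrite /transl_comb big_nil.
  by rewrite fourier0 exp_poly_nil mul0r.
have -> : transl_comb phi (p :: s) = fun t => p.1 * phi (t - p.2) + transl_comb phi s t.
  by apply/funext => t; rewrite /transl_comb big_cons.
have ht := L1_translate p.2 hp.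
rewrite (fourierD _ (L1_scale _ ht) (L1_transl_comb s hp)) (fourierZ _ _ ht).
by rewrite fourier_translate// exp_poly_cons IH; ring.
Qed.

(** The real and imaginary parts are estimated separately, hence the crude 4, which the tolerances
    [8^-1] and [m * eps / 12] below absorb. *)
Lemma fourier_bound g x : L1 g -> cabs (fourier g x) <= 4 * \int[mu]_t cabs (g t).
Proof.
move=> hg; have ic := L1R_cabs hg; have [gR gI] := hg.
have i1 : L1R (fun t => complex.Re (g t) * cos (x * t) - complex.Im (g t) * sin (x * t)).
  by apply: L1RB; [exact: L1R_cosM|exact: L1R_sinM].
have i2 : L1R (fun t => complex.Re (g t) * sin (x * t) + complex.Im (g t) * cos (x * t)).
  by apply: L1RD; [exact: L1R_sinM|exact: L1R_cosM].
have bd t (a b : R) : `|a| <= 1 -> `|b| <= 1 ->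
    `|complex.Re (g t) * a| + `|complex.Im (g t) * b| <= 2 * cabs (g t).
  move=> a1 b1; rewrite !normrM.
  have h1 : `|complex.Re (g t)| * `|a| <= cabs (g t) * 1 by apply: ler_pM => //; exact: cabs_Re.
  have h2 : `|complex.Im (g t)| * `|b| <= cabs (g t) * 1 by apply: ler_pM => //; exact: cabs_Im.
  lra.
have bR : `|fourier_re g x| <= 2 * \int[mu]_t cabs (g t).
  apply: (le_trans (norm_Rint i1)); rewrite -RintZ//.
  apply: le_Rint; [exact: L1R_norm|exact: L1RZ|] => t.
  apply: (le_trans (ler_normB _ _)); apply: bd; [exact: cos_norm_le1|exact: sin_norm_le1].
have bI : `|fourier_im g x| <= 2 * \int[mu]_t cabs (g t).
  apply: (le_trans (norm_Rint i2)); rewrite -RintZ//.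
  apply: le_Rint; [exact: L1R_norm|exact: L1RZ|] => t.
  apply: (le_trans (ler_normD _ _)); apply: bd; [exact: sin_norm_le1|exact: cos_norm_le1].
by apply: (le_trans (cabs_le _)) => /=; lra.
Qed.

Lemma fourierB g h x : L1 g -> L1 h ->
  fourier (fun t => g t - h t) x = fourier g x - fourier h x.
Proof.
move=> hg hh; under [X in fourier X]eq_fun do rewrite -mulN1r.
by rewrite fourierD ?fourierZ ?mulN1r//; exact: L1_scale.
Qed.

Lemma continuous_trig_integral (f : R -> R) (k : R -> R) : L1R f -> continuous k ->
  (forall y, `|k y| <= 1) -> continuous (fun x => \int[mu]_t (f t * k (x * t))).
Proof.
move=> hf ck k1 x.
have ckx y : continuous (fun t : R => k (y * t)).
  move=> t; apply: (@continuous_comp _ _ _ (fun t : R => y * t) k); last exact: ck.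
  by apply: cvgM; [exact: cvg_cst|exact: cvg_id].
have H := @continuity_under_integral R _ _ mu (fun x t => f t * k (x * t)) setT
  measurableT (x - 1) (x + 1) _ _ (fun t => `|f t|) (L1R_norm hf) _ x.
apply: H.
- move=> y _; apply: (L1R_mulbd hf (K := 1)) => //.
  exact: continuous_measurable_fun.
- apply/aeW => t _ y _; apply: cvgM; first exact: cvg_cst.
  apply: (@continuous_comp _ _ _ (fun y : R => y * t) k); last exact: ck.
  by apply: cvgM; [exact: cvg_id|exact: cvg_cst].
- move=> y _; apply/aeW => t _; rewrite normrM -[leRHS]mulr1.
  exact: ler_wpM2l.
- by rewrite inE/= in_itv/=; apply/andP; split; lra.
Qed.

Lemma fourier_re_continuous g : L1 g -> continuous (fourier_re g).
Proof.
move=> [gR gI].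
have -> : fourier_re g = fun x => \int[mu]_t (complex.Re (g t) * cos (x * t)) -
    \int[mu]_t (complex.Im (g t) * sin (x * t)).
  by apply/funext => x; rewrite -RintB; [|exact: L1R_cosM|exact: L1R_sinM].
move=> x; apply: cvgB; apply: continuous_trig_integral => //.
- exact: continuous_cos.
- exact: cos_norm_le1.
- exact: continuous_sin.
- exact: sin_norm_le1.
Qed.

Lemma fourier_im_continuous g : L1 g -> continuous (fourier_im g).
Proof.
move=> [gR gI].
have -> : fourier_im g = fun x => \int[mu]_t (complex.Re (g t) * sin (x * t)) +
    \int[mu]_t (complex.Im (g t) * cos (x * t)).
  by apply/funext => x; rewrite -RintD; [|exact: L1R_sinM|exact: L1R_cosM].
move=> x; apply: cvgD; apply: continuous_trig_integral => //.
- exact: continuous_sin.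
- exact: sin_norm_le1.
- exact: continuous_cos.
- exact: cos_norm_le1.
Qed.

Definition segment (a b t : R) : R := if t \in `[a, b] then 1 else 0.

Lemma segmentE (a b : R) (f : R -> R) :
  (fun t => segment a b t * f t) = f \_ (`[a, b]%classic : set R).
Proof.
apply/funext => t; rewrite /segment patchE mem_setE.
by case: ifP => _; rewrite ?mul1r ?mul0r.
Qed.

Lemma L1R_segment (a b : R) (f : R -> R) : continuous f -> L1R (fun t => segment a b t * f t).
Proof.
move=> cf; rewrite segmentE; apply: L1R_restrict; first exact: measurable_itv.
by apply: continuous_compact_integrable; [exact: segment_compact|exact: continuous_subspaceT].
Qed.

Lemma Rint_segment (a b c : R) : a <= b -> \int[mu]_t (segment a b t * c) = (b - a) * c.
Proof.
move=> ab.
have -> : (fun t => segment a b t * c) = (fun=> c) \_ (`[a, b]%classic : set R).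
  exact: (segmentE a b (fun=> c)).
rewrite -Rintegral_mkcond Rintegral_cst; last exact: measurable_itv.
rewrite /= lebesgue_measure_itv/= lte_fin; case: ifPn => [_/=|]; first by rewrite mulrC.
by rewrite -leNgt => ba; rewrite (@le_anti _ _ b a) ?ab ?ba// subrr mul0r mulr0.
Qed.

Lemma fourier_nonzero (L : set R) phi x : L1 phi -> translates_dense L phi ->
  fourier phi x != 0.
Proof.
move=> hp Hd; apply/eqP => F0.
(* The indicator of [[0, 1]] times [e^(- i x t)], whose transform at [x] has real part 1. If
   [fourier phi] vanished at [x], closeness [1 / 8] in L^1 would force it below [1 / 2]. *)
pose g t := Complex (segment 0 1 t * cos (x * t)) (segment 0 1 t * - sin (x * t)).
have cc : continuous (fun t : R => cos (x * t)) by exact: smooth2_continuous (smooth2_cosM x).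
have cs : continuous (fun t : R => - sin (x * t)).
  by move=> t; apply: cvgN; exact: (smooth2_continuous (smooth2_sinM x)).
have hg : L1 g by split; exact: L1R_segment.
have Fg : fourier_re g x = 1.
  rewrite /fourier_re -[RHS]mulr1 -[X in _ = X * _]subr0 -(Rint_segment 1 ler01).
  apply: eq_Rintegral => t _ /=.
  have := cos2Dsin2 (x * t); move: (segment 0 1 t) => c e.
  have -> : c * cos (x * t) * cos (x * t) - c * - sin (x * t) * sin (x * t) =
    c * (cos (x * t) ^+ 2 + sin (x * t) ^+ 2) by ring.
  by rewrite e.
have [|s [_ Hs]] := Hd g hg 8^-1; first by rewrite invr_gt0.
have ht := L1_transl_comb s hp.
move: Hs; rewrite L1distE// lte_fin => Hs.
have := fourier_bound x (L1B hg ht); rewrite fourierB// fourier_transl_comb// F0 mulr0 subr0.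
have := cabs_Re (fourier g x); rewrite /= Fg normr1; lra.
Qed.

Section approximation.
Variable rho : R.
Hypothesis rho0 : 0 <= rho.

Definition fourier_approx (k : R -> R[i]) := forall d : R, 0 < d ->
  exists g, L1 g /\ forall x, `|x| <= rho -> cabs (fourier g x - k x) <= d.

Lemma fourier_approxD k1 k2 : fourier_approx k1 -> fourier_approx k2 ->
  fourier_approx (fun x => k1 x + k2 x).
Proof.
move=> H1 H2 d d0; have d20 : 0 < d / 2 by rewrite divr_gt0.
have [g1 [i1 a1]] := H1 _ d20; have [g2 [i2 a2]] := H2 _ d20.
exists (fun t => g1 t + g2 t); split; first exact: L1_add.
move=> x xr; rewrite fourierD// opprD addrACA (le_trans (cabsD _ _))//.
by have := a1 x xr; have := a2 x xr; lra.
Qed.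

Lemma fourier_approxZ (c : R[i]) k : fourier_approx k -> fourier_approx (fun x => c * k x).
Proof.
move=> H d d0; have c0 := cabs_ge0 c.
have d20 : 0 < d / (cabs c + 1) by rewrite divr_gt0// ltr_wpDl.
have [g [i a]] := H _ d20; exists (fun t => c * g t); split; first exact: L1_scale.
move=> x xr; rewrite fourierZ// -mulrBr cabsM.
apply: (@le_trans _ _ ((cabs c + 1) * (d / (cabs c + 1)))); last first.
  by rewrite mulrCA divff ?mulr1// gt_eqF// ltr_wpDl.
by apply: ler_pM; [|exact: cabs_ge0|rewrite lerDl|exact: a].
Qed.

Lemma fourier_approx0 : fourier_approx (fun=> 0).
Proof.
move=> d d0; exists (fun=> 0); split; first exact: L1_zero.
by move=> x _; rewrite fourier0 subrr /cabs Normc.normc0 ltW.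
Qed.

Lemma sin_lipschitz (a b : R) : `|sin a - sin b| <= `|a - b|.
Proof.
rewrite -!cosBpihalf; apply: (le_trans (cos_lipschitz _ _)).
by rewrite (_ : a - pi / 2 - (b - pi / 2) = a - b)//; ring.
Qed.

(* [expi (a x)] is the limit of the transforms of [1_[a, a+h] / h]. *)
Lemma fourier_approx_expi (a : R) : fourier_approx (fun x => expi (a * x)).
Proof.
(* The cosine and the sine each contribute an error [h * rho]; [rho + 1] also covers [rho = 0]. *)
move=> d d0; pose h := d / (2 * (rho + 1)).
have h0 : 0 < h by rewrite divr_gt0// mulr_gt0// ltr_wpDl.
have hr : 2 * (h * rho) <= d.
  have : h * (2 * (rho + 1)) = d by rewrite /h; field; rewrite gt_eqF// ltr_wpDl.
  lra.
exists (fun t => Complex (segment a (a + h) t * h^-1) 0); split.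
  split => /=; last exact: L1R0.
  by apply: L1R_segment; exact: cst_continuous.
move=> x xr.
have key (k : R -> R) : continuous k -> (forall u v, `|k u - k v| <= `|u - v|) ->
    `|\int[mu]_t (segment a (a + h) t * (h^-1 * k (x * t))) - k (a * x)| <= h * rho.
  move=> ck kl; have ckx : continuous (fun t : R => k (x * t)).
    move=> t; apply: (@continuous_comp _ _ _ (fun t : R => x * t) k); last exact: ck.
    by apply: cvgM; [exact: cvg_cst|exact: cvg_id].
  have -> : k (a * x) = \int[mu]_t (segment a (a + h) t * (h^-1 * k (a * x))).
    by rewrite Rint_segment ?lerDl ?(ltW h0)//; field; rewrite gt_eqF.
  have i1 : L1R (fun t => segment a (a + h) t * (h^-1 * k (x * t))).
    by apply: L1R_segment; apply: continuousM => //; exact: cst_continuous.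
  have i2 : L1R (fun t => segment a (a + h) t * (h^-1 * k (a * x))).
    by apply: L1R_segment; exact: cst_continuous.
  rewrite -(RintB i1 i2); apply: (le_trans (norm_Rint (L1RB i1 i2))).
  have -> : h * rho = \int[mu]_t (segment a (a + h) t * rho).
    by rewrite Rint_segment ?lerDl ?(ltW h0)//; ring.
  apply: le_Rint.
  - exact: L1R_norm (L1RB i1 i2).
  - by apply: L1R_segment; exact: cst_continuous.
  - move=> t; rewrite -mulrBr /segment; case: ifP => [|_]; last by rewrite !mul0r normr0.
    rewrite in_itv/= => /andP[t1 t2]; rewrite !mul1r -mulrBr normrM gtr0_norm ?invr_gt0//.
    rewrite ler_pdivrMl//; apply: (le_trans (kl _ _)).
    rewrite (_ : x * t - a * x = (t - a) * x); last by ring.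
    by rewrite normrM ger0_norm ?subr_ge0//; apply: ler_pM => //; rewrite ?subr_ge0//; lra.
apply: (le_trans (cabs_le _)); apply: le_trans hr; rewrite mulrDl mul1r.
rewrite ReD ImD ReN ImN /= /fourier_re /fourier_im; apply: lerD.
- rewrite (_ : \int[mu]_t _ = \int[mu]_t (segment a (a + h) t * (h^-1 * cos (x * t)))).
    by apply: key; [exact: continuous_cos|exact: cos_lipschitz].
  by apply: eq_Rintegral => t _ /=; rewrite mul0r subr0 mulrA.
- rewrite (_ : \int[mu]_t _ = \int[mu]_t (segment a (a + h) t * (h^-1 * sin (x * t)))).
    by apply: key; [exact: continuous_sin|exact: sin_lipschitz].
  by apply: eq_Rintegral => t _ /=; rewrite mul0r addr0 mulrA.
Qed.

Lemma fourier_approx_exp_poly s : fourier_approx (exp_poly s).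
Proof.
elim: s => [|p s IH].
  have -> : exp_poly [::] = fun=> 0 :> R[i] by apply/funext => x; exact: exp_poly_nil.
  exact: fourier_approx0.
have -> : exp_poly (p :: s) = fun x => p.1 * expi (p.2 * x) + exp_poly s x.
  by apply/funext => x; exact: exp_poly_cons.
by apply: fourier_approxD => //; apply: fourier_approxZ; exact: fourier_approx_expi.
Qed.

Lemma fourier_approx_real (f : R -> R) : continuous f ->
  fourier_approx (fun x => Complex (f x) 0).
Proof.
move=> cf d d0; have d20 : 0 < d / 2 by rewrite divr_gt0.
have rr : - rho <= rho by have := rho0; lra.
have cn : {within `[- rho, rho], continuous (fun x => `|f x|)}.
  by apply: continuous_subspaceT => x; apply: cvg_norm; exact: cf.
have [c _ Hc] := EVT_max rr cn.
(* Clamping provides the bound on the whole line that [trig_poly_approx] requires and leaves [f]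
   unchanged on the segment. *)
have cfc : continuous (f \o clamp rho).
  by apply: within_clamp_continuous => //; exact: continuous_subspaceT.
have [|Q [[s [_ sQ]] Q1 _]] := trig_poly_approx rho cfc d20 (K := `|f c|).
  by move=> x; apply: Hc; exact: clamp_itv.
have [g [ig ag]] := fourier_approx_exp_poly s d20.
exists g; split => // x xr.
rewrite -(subrKA (exp_poly s x)) (le_trans (cabsD _ _))//.
have h1 := ag x xr; have := Q1 x xr.
rewrite /= clamp_id; last by rewrite in_itv/= -ler_norml.
move=> h2; rewrite [leRHS]splitr; apply: lerD => //.
apply: (le_trans (cabs_le _)).
by rewrite ReD ImD ReN ImN sQ /= subrr normr0 addr0 distrC.
Qed.

Lemma fourier_approx_continuous (f1 f2 : R -> R) : continuous f1 -> continuous f2 ->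
  fourier_approx (fun x => Complex (f1 x) (f2 x)).
Proof.
move=> c1 c2.
have -> : (fun x => Complex (f1 x) (f2 x)) =
    (fun x => Complex (f1 x) 0 + Complex 0 1 * Complex (f2 x) 0).
  by apply/funext => x; apply: complex_eq; rewrite ?ReD ?ImD ?ReM ?ImM/=; ring.
by apply: fourier_approxD; [|apply: fourier_approxZ]; exact: fourier_approx_real.
Qed.

End approximation.

Lemma dense_exp_complete (L : set R) phi rho : 0 < rho -> L1 phi ->
  translates_dense L phi -> exp_complete L rho.
Proof.
move=> r0 hp Hd f cRe cIm eps e0.
have rr : - rho <= rho by lra.
pose N2 x : R := fourier_re phi x ^+ 2 + fourier_im phi x ^+ 2.
have cR := fourier_re_continuous hp; have cI := fourier_im_continuous hp.
have cN2 : continuous N2.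
  by move=> x; apply: cvgD; (apply: continuousM => //).
have [c _ Hc] := EVT_min rr (continuous_subspaceT cN2).
have cabsE x : cabs (fourier phi x) = Num.sqrt (N2 x) by [].
pose m : R := cabs (fourier phi c).
have m0 : 0 < m.
  rewrite lt_neqAle cabs_ge0 andbT eq_sym; apply/eqP => /cabs_eq0/eqP.
  by apply/negP; exact: fourier_nonzero hp Hd.
have mle x : x \in `[- rho, rho] -> m <= cabs (fourier phi x).
  by move=> xr; rewrite /m !cabsE ler_wsqrtr// Hc.
have cF1 := within_clamp_continuous (ltW r0) cRe.
have cF2 := within_clamp_continuous (ltW r0) cIm.
pose k1 x : R := complex.Re (f (clamp rho x)) * fourier_re phi x -
  complex.Im (f (clamp rho x)) * fourier_im phi x.
pose k2 x : R := complex.Re (f (clamp rho x)) * fourier_im phi x +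
  complex.Im (f (clamp rho x)) * fourier_re phi x.
have ck1 : continuous k1.
  by move=> x; apply: cvgB; [exact: (continuousM cF1 cR)|exact: (continuousM cF2 cI)].
have ck2 : continuous k2.
  by move=> x; apply: cvgD; [exact: (continuousM cF1 cI)|exact: (continuousM cF2 cR)].
have kE x : Complex (k1 x) (k2 x) = f (clamp rho x) * fourier phi x.
  by apply: complex_eq; rewrite ?ReM ?ImM.
(* One third of [m * eps] for approximating [f * fourier phi] by [fourier g], and another from
   [4 * (m * eps / 12)] for replacing [g] by translates; dividing by [fourier phi], of modulus at
   least [m], leaves less than [eps]. *)
have d0 : 0 < m * eps / 3 by rewrite divr_gt0// mulr_gt0.
have [g [ig ag]] := fourier_approx_continuous (ltW r0) ck1 ck2 d0.
have [|s [sL Hs]] := Hd g ig (m * eps / 12); first by rewrite divr_gt0// mulr_gt0.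
have ht := L1_transl_comb s hp.
move: Hs; rewrite L1distE// lte_fin => Hs.
exists s; split => // x xr.
have xr' : `|x| <= rho by rewrite ler_norml; move: xr; rewrite in_itv.
have h1 := ag x xr'; rewrite kE clamp_id// in h1.
have := fourier_bound x (L1B ig ht); rewrite fourierB// fourier_transl_comb// => h2.
have h3 : cabs ((f x - exp_poly s x) * fourier phi x) < m * eps.
  have -> : (f x - exp_poly s x) * fourier phi x =
    - (fourier g x - f x * fourier phi x) + (fourier g x - exp_poly s x * fourier phi x) by ring.
  apply: (le_lt_trans (cabsD _ _)); rewrite {1}/cabs normcN -/(cabs _).
  have me : 0 < m * eps by rewrite mulr_gt0.
  lra.
rewrite cabsM in h3; have h4 := mle x xr.
rewrite -(ltr_pM2r m0) mulrC; apply: le_lt_trans (_ : _ <= cabs (f x - exp_poly s x) * cabs (fourier phi x)) _.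
  by rewrite mulrC ler_wpM2l// cabs_ge0.
by rewrite [eps * m]mulrC.
Qed.

End GeneratorToRadius.

Theorem theorem1 (R : realType) (L : set R) (hL : discrete_set L) :
  (exists phi : R -> R[i], L1 phi /\ translates_dense L phi) <->
  spectral_radius L = +oo%E.
Proof.
split => [[phi [hp Hd]]|/radius_pinfty_complete]; last exact: complete_generator.
have le_radius (rho : R) : 0 < rho -> (rho%:E <= spectral_radius L)%E.
  move=> r0; apply: ereal_sup_ubound; right; exists rho => //; split => //.
  exact: dense_exp_complete r0 hp Hd.
case: (spectral_radius L) le_radius => [r| |] le_radius //.
- have r1 : 0 < Num.max r 0 + 1 by rewrite ltr_wpDl// le_max lexx orbT.
  have := le_radius _ r1; rewrite lee_fin => h.
  have rm : r <= Num.max r 0 by rewrite le_max lexx.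
  by have := le_trans (lerD rm (lexx 1)) h; rewrite gerDl ler10.
- by have := le_radius 1 ltr01.
Qed.
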